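(* Let $C$ be a generalized Cantor ladder with $m\ge2$ steps which has a critical point, i.e. $\rho_i<\rho_m$ for some $i$, and let $\varsigma^o=\min_{i:\,\rho_i<\rho_m}\frac{g_i}{\rho_m-\rho_i}$ be its critical point. Then for any $\varsigma'<\varsigma^o$, with $\mathfrak{I}'=\{\varsigma\in\widehat{\mathfrak{I}}:1<\varsigma<\varsigma'\}$ (a finite set), as $\lambda\to\infty$, $$E(\lambda)=H(\lambda)\lambda^\alpha e^\lambda-\left(\frac{\Delta_{2m-2}}{\Delta_{2m-1}}+\Delta_{2m-3}\,H\Big(\frac{\rho_{m-1}}{\rho_m}\lambda\Big)(\rho_{m-1}\lambda)^\alpha\right)+\sum_{\varsigma\in\mathfrak{I}'}c_\varsigma(\lambda)e^{(1-\varsigma)\lambda}+O\big(e^{(1-\varsigma')\lambda}\big).$$ Moreover, if there is no $\varsigma_*<\varsigma^o$ such that $c_\varsigma\equiv0$ for all $\varsigma\in\widehat{\mathfrak{I}}$ with $\varsigma_*<\varsigma<\varsigma^o$, then the sum can have arbitrarily many terms: for every $N$ there is $\varsigma'<\varsigma^o$ such that at least $N$ of the functions $c_\varsigma$, $\varsigma\in\mathfrak{I}'$, are not identically zero. The set $\widehat{\mathfrak{I}}$ and the functions $c_\varsigma$ are those defined in the context.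
   Context: Generalized Cantor ladder with $m$ steps ($m\ge2$): let $I_k=[a_k,b_k]\subset[0,1]$, $k=1,\dots,m$, with $a_k<b_k$, $b_k\le a_{k+1}$, $a_1=0$, $b_m=1$, and let $\rho_1,\dots,\rho_m>0$ with $\sum_k\rho_k=1$. Put $\Delta_{2k-1}=b_k-a_k>0$ ($1\le k\le m$), $\Delta_{2k}=a_{k+1}-b_k\ge0$ ($1\le k\le m-1$), $h_0=0$, $h_k=\sum_{i=1}^k\rho_i$, $g_k=1-h_k$. The ladder is the unique continuous function $C:[0,1]\to[0,1]$ with $C(0)=0$, $C(1)=1$ such that $C(t)=h_{k-1}+\rho_kC\big(\frac{t-a_k}{\Delta_{2k-1}}\big)$ for $t\in[a_k,b_k]$ and $C(t)=h_k$ for $t\in[b_k,a_{k+1}]$. It is monotone. For $\lambda\ge0$ let $E(\lambda)=\int_0^1e^{\lambda C(t)}\,dt$. Put $\eta=1/\rho_m>1$ and $\alpha=\log_\eta(\Delta_{2m-1})<0$. The function $H$: put $f(\lambda)=E(\eta\lambda)-\Delta_{2m-1}e^{(\eta-1)\lambda}E(\lambda)$, $f_1(\lambda)=\dfrac{f(\lambda)}{\Delta_{2m-1}\lambda^\alpha e^{\eta\lambda}}$, and $H(\lambda)=\sum_{k\in\mathbb{Z}}f_1(\eta^k\lambda)$ for $\lambda>0$ (the series converges). Then $H(\lambda)=\Phi(\log_\eta\lambda)$ with $\Phi$ $1$-periodic; equivalently, $H$ is the unique function on $(0,\infty)$ of this form such that $E(\lambda)=H(\lambda)\lambda^\alpha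 e^\lambda+O(1)$ as $\lambda\to\infty$. Write $H_1(\lambda)=H(\lambda)\lambda^\alpha$. Exponents: $\mathfrak{I}_1=\{\eta g_k:1\le k\le m-1\}$ (note $\eta g_{m-1}=1$). Let $\widehat{\mathfrak{I}}\subset\mathbb{R}$ be the smallest set containing $\mathfrak{I}_1$ and closed under the maps $\varsigma\mapsto\eta\varsigma$ and $\varsigma\mapsto\eta(g_i+\rho_i\varsigma)$, $1\le i\le m-1$. One has $\varsigma^o>1$; the set $\widehat{\mathfrak{I}}$ has only finitely many elements below any $\varsigma'<\varsigma^o$, and the least of its elements is $1$. Coefficients: for $1\le k\le m-1$ put $c^1_{\eta g_k}(\lambda)=-\dfrac{\Delta_{2k-1}H_1(\eta\rho_k\lambda)+\Delta_{2k}}{\Delta_{2m-1}}$, and $c^1_\varsigma\equiv0$ for $\varsigma\notin\mathfrak{I}_1$. For $\varsigma<\varsigma^o$ the functions $c_\varsigma:(0,\infty)\to\mathbb{R}$ are defined by $c_\varsigma\equiv0$ for $\varsigma\notin\widehat{\mathfrak{I}}$ and, recursively in increasing $\varsigma\in\widehat{\mathfrak{I}}$, $\varsigma<\varsigma^o$, by $$c_\varsigma(\lambda)=c^1_\varsigma(\lambda)+\frac1{\Delta_{2m-1}}c_{\varsigma/\eta}(\eta\lambda)-\sum_{i=1}^{m-1}\frac{\Delta_{2i-1}}{\Delta_{2m-1}}\,c_{(\varsigma/\eta-g_i)/\rho_i}(\rho_i\eta\lambda)$$ (all indices on the right that lie in $\widehat{\mathfrak{I}}$ are smaller than $\varsigma$).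 *)

(* Defs.v *)
(* Stdlib real numbers with Coquelicot. *)
From Stdlib Require Import Reals Lra Lia List ClassicalEpsilon.
From Coquelicot Require Import Coquelicot.
Open Scope R_scope.

(* The sequences [a], [b], [rho] are indexed as in the mathematics, by
   k = 1, ..., m; their values at other indices are irrelevant. *)
Record ladder := Ladder {
  steps : nat;
  a : nat -> R;
  b : nat -> R;
  rho : nat -> R;
  steps_ge2 : (2 <= steps)%nat;
  a_lt_b : forall k, (1 <= k <= steps)%nat -> a k < b k;
  I_sub01 : forall k, (1 <= k <= steps)%nat -> 0 <= a k /\ b k <= 1;
  b_le_a : forall k, (1 <= k <= steps - 1)%nat -> b k <= a (k + 1)%nat;
  a_first : a 1%nat = 0;
  b_last : b steps = 1;
  rho_pos : forall k, (1 <= k <= steps)%nat -> 0 < rho k;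
  rho_sum : sum_n_m rho 1 steps = 1
}.

Section Ladder.
Variable L : ladder.

Local Notation m := (steps L).
Local Notation rho := (rho L).

(* [len k] is Delta_{2k-1} and [gap k] is Delta_{2k}. *)
Definition len (k : nat) : R := b L k - a L k.
Definition gap (k : nat) : R := a L (k + 1)%nat - b L k.

Definition h (k : nat) : R := sum_n_m rho 1 k.
Definition g (k : nat) : R := 1 - h k.

Definition eta : R := 1 / rho m.
Definition alpha : R := ln (len m) / ln eta.

(* [C] is the ladder function; only its restriction to [0,1] matters, and
   continuity is relative to [0,1]. *)
Definition is_ladder_function (C : R -> R) : Prop :=
  continuous_on (fun t => 0 <= t <= 1) C /\
  (forall t, 0 <= t <= 1 -> 0 <= C t <= 1) /\
  C 0 = 0 /\ C 1 = 1 /\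
  (forall k t, (1 <= k <= m)%nat -> a L k <= t <= b L k ->
     C t = h (k - 1) + rho k * C ((t - a L k) / len k)) /\
  (forall k t, (1 <= k <= m - 1)%nat -> b L k <= t <= a L (k + 1)%nat ->
     C t = h k).

Definition has_critical_point : Prop :=
  exists i, (1 <= i <= m)%nat /\ rho i < rho m.

(* [so] is the minimum of g_i / (rho_m - rho_i) over the i with rho_i < rho_m. *)
Definition is_critical_point (so : R) : Prop :=
  (exists i, (1 <= i <= m)%nat /\ rho i < rho m /\
     so = g i / (rho m - rho i)) /\
  (forall i, (1 <= i <= m)%nat -> rho i < rho m ->
     so <= g i / (rho m - rho i)).

Inductive Ihat : R -> Prop :=
| Ihat_base k : (1 <= k <= m - 1)%nat -> Ihat (eta * g k)
| Ihat_eta s : Ihat s -> Ihat (eta * s)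
| Ihat_step i s : (1 <= i <= m - 1)%nat -> Ihat s ->
    Ihat (eta * (g i + rho i * s)).

Section Asymptotics.
Variable C : R -> R.

Definition E (l : R) : R := RInt (fun t => exp (l * C t)) 0 1.

Definition f (l : R) : R :=
  E (eta * l) - len m * exp ((eta - 1) * l) * E l.

Definition f1 (l : R) : R :=
  f l / (len m * Rpower l alpha * exp (eta * l)).

Definition Zseries (u : Z -> R) : R :=
  Series (fun n => u (Z.of_nat n)) + Series (fun n => u (- Z.of_nat (S n))%Z).

Definition H (l : R) : R := Zseries (fun k => f1 (powerRZ eta k * l)).

Definition H1 (l : R) : R := H l * Rpower l alpha.

(* The numbers eta * g_k, 1 <= k <= m-1, are distinct, so at most one term of
   the sum is nonzero. *)
Definition c1 (s l : R) : R :=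
  sum_n_m (fun k =>
    if Req_EM_T s (eta * g k)
    then - (len k * H1 (eta * rho k * l) + gap k) / len m
    else 0) 1 (m - 1).

Definition c_recursion (c : R -> R -> R) (s l : R) : R :=
  c1 s l + 1 / len m * c (s / eta) (eta * l)
  - sum_n_m (fun i =>
      len i / len m * c ((s / eta - g i) / rho i) (rho i * eta * l))
    1 (m - 1).

(* The functions c_s, s < so, as functions on (0,+oo); the values [c s l] with
   so <= s or l <= 0 are irrelevant. For s < so in [Ihat] all the indices on the
   right-hand side of the recursion are < s, and such a family exists by
   [coefficients_exist] below. *)
Definition is_coefficients (so : R) (c : R -> R -> R) : Prop :=
  (forall s l, s < so -> ~ Ihat s -> 0 < l -> c s l = 0) /\
  (forall s l, s < so -> Ihat s -> 0 < l -> c s l = c_recursion c s l).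

End Asymptotics.
End Ladder.

Definition bigO_infty (u v : R -> R) : Prop :=
  exists K, Rbar_locally p_infty (fun x => Rabs (u x) <= K * Rabs (v x)).

Definition sum_over (l : list R) (F : R -> R) : R :=
  fold_right Rplus 0 (map F l).

Definition enumerates (l : list R) (P : R -> Prop) : Prop :=
  NoDup l /\ forall s, In s l <-> P s.

Section Existence.
Variable L : ladder.
Local Notation m := (steps L).
Local Notation rho := (rho L).
Local Notation g := (g L).
Local Notation eta := (eta L).

Lemma h_le_last : forall k, (1 <= k <= m - 1)%nat -> h L k <= 1 - rho m.
Proof.
intros k Hk.
pose proof (steps_ge2 L).
assert (mono : forall d, (k + d <= m - 1)%nat -> h L k <= h L (k + d)).
{ induction d as [|d IH]; intros Hd.
  - rewrite Nat.add_0_r; lra.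
  - replace (k + S d)%nat with (S (k + d)) by lia.
    unfold h in *; rewrite sum_n_Sm by lia.
    unfold plus; simpl.
    pose proof (rho_pos L (S (k + d)) ltac:(lia)).
    specialize (IH ltac:(lia)); lra. }
specialize (mono (m - 1 - k)%nat ltac:(lia)).
replace (k + (m - 1 - k))%nat with (m - 1)%nat in mono by lia.
assert (h L m = h L (m - 1) + rho m).
{ unfold h; replace m with (S (m - 1)) at 1 by lia.
  rewrite sum_n_Sm by lia.
  replace (S (m - 1)) with m by lia; reflexivity. }
pose proof (rho_sum L); unfold h in *; lra.
Qed.

Lemma g_ge_last : forall k, (1 <= k <= m - 1)%nat -> rho m <= g k.
Proof. intros k Hk; unfold Defs.g; pose proof (h_le_last k Hk); lra. Qed.

Lemma rho_last : 0 < rho m < 1.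
Proof.
pose proof (steps_ge2 L).
split; [apply rho_pos; lia|].
pose proof (h_le_last 1 ltac:(lia)) as Hh.
unfold h in Hh; rewrite sum_n_n in Hh.
pose proof (rho_pos L 1 ltac:(lia)); lra.
Qed.

Lemma Ihat_ge1 : forall s, Ihat L s -> 1 <= s.
Proof.
destruct rho_last as [r0 r1].
assert (He : 0 < eta) by (unfold Defs.eta; apply Rdiv_lt_0_compat; lra).
assert (Her : eta * rho m = 1) by (unfold Defs.eta; field; lra).
intros s Hs; induction Hs as [k Hk|s _ IH|i s Hi _ IH].
- pose proof (g_ge_last k Hk); nra.
- nra.
- pose proof (g_ge_last i Hi).
  pose proof (rho_pos L i ltac:(lia)).
  assert (0 <= rho i * s) by nra; nra.
Qed.

Lemma index_decrease : forall so s0, is_critical_point L so -> s0 < so ->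
  exists d, 0 < d /\ forall s, 1 <= s <= s0 -> s / eta <= s - d /\
    forall i, (1 <= i <= m - 1)%nat -> (s / eta - g i) / rho i <= s - d.
Proof.
intros so s0 [_ Hmin] Hs0.
destruct rho_last as [r0 r1].
assert (Hdiv : forall s, s / eta = s * rho m)
  by (intros s; unfold Defs.eta; field; lra).
assert (Hn : forall n, (n <= m - 1)%nat -> exists d, 0 < d /\ forall s,
  1 <= s <= s0 -> s / eta <= s - d /\
  forall i, (1 <= i <= n)%nat -> (s / eta - g i) / rho i <= s - d).
{ induction n as [|n IH]; intros Hn.
  - exists (1 - rho m); split; [lra|]; intros s Hs; split.
    + rewrite Hdiv; nra.
    + intros i Hi; lia.
  - destruct IH as [d [d0 Hd]]; [lia|].
    assert (Hi : exists e, 0 < e /\ forall s, 1 <= s <= s0 ->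
      (s / eta - g (S n)) / rho (S n) <= s - e).
    { pose proof (rho_pos L (S n) ltac:(lia)) as rp.
      pose proof (g_ge_last (S n) ltac:(lia)) as gp.
      assert (Heq : forall s, (s / eta - g (S n)) / rho (S n)
        = s - (g (S n) - s * (rho m - rho (S n))) / rho (S n))
        by (intros s; rewrite Hdiv; field; lra).
      destruct (Rlt_dec (rho (S n)) (rho m)) as [Hlt|Hge].
      - exists ((rho m - rho (S n)) * (so - s0) / rho (S n)); split.
        + apply Rdiv_lt_0_compat; nra.
        + intros s Hs; rewrite Heq.
          apply Rplus_le_compat_l, Ropp_le_contravar.
          apply Rmult_le_compat_r; [left; apply Rinv_0_lt_compat; lra|].
          pose proof (Hmin (S n) ltac:(lia) Hlt) as Hso.
          assert (so * (rho m - rho (S n)) <= g (S n)).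
          { apply (Rmult_le_compat_r (rho m - rho (S n))) in Hso; [|lra].
            replace (g (S n) / (rho m - rho (S n)) * (rho m - rho (S n)))
              with (g (S n)) in Hso by (field; lra); exact Hso. }
          nra.
      - exists (g (S n) / rho (S n)); split.
        + apply Rdiv_lt_0_compat; lra.
        + intros s Hs; rewrite Heq.
          apply Rplus_le_compat_l, Ropp_le_contravar.
          apply Rmult_le_compat_r; [left; apply Rinv_0_lt_compat; lra|].
          nra. }
    destruct Hi as [e [e0 He]].
    exists (Rmin d e); split; [apply Rmin_pos; lra|].
    intros s Hs; pose proof (Rmin_l d e); pose proof (Rmin_r d e).
    destruct (Hd s Hs) as [P1 P2]; split; [lra|].
    intros i Hi; destruct (Nat.eq_dec i (S n)) as [->|Hne].
    + specialize (He s Hs); lra.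
    + specialize (P2 i ltac:(lia)); lra. }
exact (Hn (m - 1)%nat (Nat.le_refl _)).
Qed.

Fixpoint c_iter (C : R -> R) (n : nat) (s l : R) : R :=
  match n with
  | O => 0
  | S n => if excluded_middle_informative (Ihat L s)
           then c_recursion L C (c_iter C n) s l else 0
  end.

Lemma c_iter_0 : forall C n s l, ~ Ihat L s -> c_iter C n s l = 0.
Proof.
intros C [|n] s l Hs; simpl; [reflexivity|].
destruct (excluded_middle_informative (Ihat L s)); [contradiction|reflexivity].
Qed.

Lemma c_recursion_ext : forall C c c' s,
  (forall l, c (s / eta) l = c' (s / eta) l) ->
  (forall i l, (1 <= i <= m - 1)%nat ->
     c ((s / eta - g i) / rho i) l = c' ((s / eta - g i) / rho i) l) ->
  forall l, c_recursion L C c s l = c_recursion L C c' s l.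
Proof.
intros C c c' s P1 P2 l; unfold c_recursion; rewrite P1.
apply (f_equal (Rminus _)), sum_n_m_ext_loc.
intros i Hi; rewrite P2; [reflexivity|lia].
Qed.

Lemma c_iter_stable : forall C so s, is_critical_point L so -> s < so ->
  exists N, forall s', s' <= s -> forall n, (N <= n)%nat -> forall l,
    c_iter C n s' l = c_iter C N s' l.
Proof.
intros C so s Hso Hs.
destruct (index_decrease so s Hso Hs) as [d [d0 Hd]].
assert (Hk : forall k s', s' <= s -> s' <= INR k * d ->
  forall n, (k <= n)%nat -> forall l, c_iter C n s' l = c_iter C k s' l).
{ induction k as [|k IH]; intros s' Hs' Hb n Hn l;
    destruct (excluded_middle_informative (Ihat L s')) as [Hi|Hi];
    try (rewrite 2!c_iter_0 by exact Hi; reflexivity);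
    pose proof (Ihat_ge1 s' Hi) as Hs1.
  - simpl in Hb; lra.
  - destruct n as [|n]; [lia|].
    rewrite S_INR in Hb.
    destruct (Hd s' (conj Hs1 Hs')) as [He Hg].
    simpl; destruct (excluded_middle_informative (Ihat L s')); [|contradiction].
    apply c_recursion_ext.
    + intros l'; apply IH; [lra|lra|lia].
    + intros j l' Hj; specialize (Hg j Hj); apply IH; [lra|lra|lia]. }
destruct (Rle_lt_dec s 0) as [Hneg|Hpos].
- exists O; intros s' Hs'; apply Hk; simpl; lra.
- destruct (nfloor_ex (s / d)) as [N HN].
  { left; apply Rdiv_lt_0_compat; lra. }
  exists (S N); intros s' Hs'; apply Hk; [exact Hs'|].
  rewrite S_INR.
  assert (s = s / d * d) by (field; lra).
  nra.
Qed.

Lemma coefficients_exist : forall C so, is_critical_point L so ->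
  exists c, is_coefficients L C so c.
Proof.
intros C so Hso.
assert (HN : exists c : R -> R -> R, forall s, s < so ->
  exists N, forall s', s' <= s -> forall n, (N <= n)%nat -> forall l,
    c_iter C n s' l = c s' l).
{ exists (fun s l => real (Lim_seq (fun n => c_iter C n s l))).
  intros s Hs; destruct (c_iter_stable C so s Hso Hs) as [N HN].
  exists N; intros s' Hs' n Hn l.
  rewrite (is_lim_seq_unique _ (c_iter C N s' l)).
  - simpl; apply HN; assumption.
  - apply is_lim_seq_ext_loc with (fun _ => c_iter C N s' l).
    + exists N; intros p Hp; symmetry; apply HN; assumption.
    + apply is_lim_seq_const. }
destruct HN as [c Hc]; exists c; split; intros s l Hs Hi Hl;
  destruct (Hc s Hs) as [N HN].
- rewrite <- (HN s (Rle_refl s) N (Nat.le_refl N)); apply c_iter_0; exact Hi.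
- rewrite <- (HN s (Rle_refl s) (S N) ltac:(lia)); simpl.
  destruct (excluded_middle_informative (Ihat L s)); [|contradiction].
  destruct (index_decrease so s Hso Hs) as [d [d0 Hd]].
  destruct (Hd s (conj (Ihat_ge1 s Hi) (Rle_refl s))) as [He Hg].
  apply c_recursion_ext.
  + intros l'; apply HN; [lra|lia].
  + intros j l' Hj; specialize (Hg j Hj); apply HN; [lra|lia].
Qed.

End Existence.

(* Main.v *)
(* Write the self-similarity of [C] as E(eta l) = len_m e^((eta-1)l) E(l) + f(l).
   With G(l) = E(l) / (l^alpha e^l) one has f1(l) = G(eta l) - G(l), so the
   series defining H telescopes to H(l) = lim G(eta^n l), and the remainder
   R(l) = E(l) - H(l) l^alpha e^l is bounded. Substituting
   E = H l^alpha e^l + R in f turns the self-similarity into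
     R(l) = sum_k B_k(l) e^((1 - eta g_k) l) + len_m^-1 e^((1-eta)l) R(eta l)
            - sum_k (len_k / len_m) e^((1 - eta (g_k + rho_k)) l) R(rho_k eta l),
   and the recursion for [c] says exactly that the sum S_x of c_s(l) e^((1-s)l)
   over s < x satisfies the same equation, with the first sum restricted to
   eta g_k < x and S_x on the right replaced by S_y at smaller indices y. As long
   as x < so these indices decrease by a fixed amount, so R - S_x =
   O(e^((1-x)l)) follows by induction from the case x <= 1, where S_x = 0. *)
Require Import Defs.
From Stdlib Require Import Reals List Lra Lia Permutation FinFun.
From Stdlib Require Import ClassicalEpsilon.
From Coquelicot Require Import Coquelicot.
Open Scope R_scope.

(** * Finite sums over index ranges and over lists *)

Lemma sum_n_m_Rplus (u v : nat -> R) n k :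
  sum_n_m (fun i => u i + v i) n k = sum_n_m u n k + sum_n_m v n k.
Proof. exact (sum_n_m_plus u v n k). Qed.

Lemma sum_n_m_Rmult (x : R) (u : nat -> R) n k :
  sum_n_m (fun i => x * u i) n k = x * sum_n_m u n k.
Proof. exact (sum_n_m_mult_l x u n k). Qed.

Lemma sum_n_m_Rle (u v : nat -> R) n k :
  (forall i, (n <= i <= k)%nat -> u i <= v i) ->
  sum_n_m u n k <= sum_n_m v n k.
Proof.
revert n; induction k as [|k IH]; intros n Huv.
- destruct n; [rewrite 2!sum_n_n; apply Huv; lia|].
  rewrite 2!sum_n_m_zero by lia; apply Rle_refl.
- destruct (Nat.le_gt_cases n (S k)).
  + rewrite 2!sum_n_Sm by lia.
    apply Rplus_le_compat; [apply IH; intros; apply Huv; lia|apply Huv; lia].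
  + rewrite 2!sum_n_m_zero by lia; apply Rle_refl.
Qed.

Lemma sum_n_m_R0 (u : nat -> R) n k :
  (forall i, (n <= i <= k)%nat -> u i = 0) -> sum_n_m u n k = 0.
Proof.
intros Hu; rewrite (sum_n_m_ext_loc u (fun _ => 0) n k Hu).
exact (sum_n_m_const_zero n k).
Qed.

Lemma sum_over_cons x l F : sum_over (x :: l) F = F x + sum_over l F.
Proof. reflexivity. Qed.

Lemma sum_over_ext l F G :
  (forall x, In x l -> F x = G x) -> sum_over l F = sum_over l G.
Proof.
intros HFG; unfold sum_over; rewrite (map_ext_in F G l); [reflexivity|exact HFG].
Qed.

Lemma sum_over_plus l F G :
  sum_over l (fun x => F x + G x) = sum_over l F + sum_over l G.
Proof.
induction l as [|x l IH]; [unfold sum_over; simpl; ring|].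
rewrite 3!sum_over_cons, IH; ring.
Qed.

Lemma sum_over_scal l k F : sum_over l (fun x => k * F x) = k * sum_over l F.
Proof.
induction l as [|x l IH]; [unfold sum_over; simpl; ring|].
rewrite 2!sum_over_cons, IH; ring.
Qed.

Lemma sum_over_0 l F : (forall x, In x l -> F x = 0) -> sum_over l F = 0.
Proof.
intros HF; rewrite (sum_over_ext l F (fun x => 0 * F x)).
- rewrite sum_over_scal; ring.
- intros x Hx; rewrite HF by exact Hx; ring.
Qed.

Lemma sum_over_sum_n_m l (F : nat -> R -> R) n k :
  sum_over l (fun x => sum_n_m (fun i => F i x) n k)
  = sum_n_m (fun i => sum_over l (F i)) n k.
Proof.
induction l as [|x l IH].
- symmetry; apply sum_n_m_R0; reflexivity.
- rewrite sum_over_cons, IH, <- sum_n_m_Rplus; reflexivity.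
Qed.

Lemma sum_over_perm l l' F : Permutation l l' -> sum_over l F = sum_over l' F.
Proof.
intros HP; induction HP as [|x l l' _ IH|x y l|l1 l2 l3 _ IH1 _ IH2].
- reflexivity.
- rewrite 2!sum_over_cons, IH; reflexivity.
- rewrite 4!sum_over_cons; ring.
- rewrite IH1; exact IH2.
Qed.

Definition nonzero (F : R -> R) (x : R) : bool :=
  if Req_EM_T (F x) 0 then false else true.

Lemma nonzeroE F x : nonzero F x = true <-> F x <> 0.
Proof.
unfold nonzero; destruct (Req_EM_T (F x) 0); split; congruence.
Qed.

Lemma sum_over_filter_nonzero l F :
  sum_over (filter (nonzero F) l) F = sum_over l F.
Proof.
induction l as [|x l IH]; [reflexivity|].
cbn [filter]; destruct (nonzero F x) eqn:Hx;
  rewrite ?sum_over_cons, IH; [reflexivity|].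
destruct (Req_EM_T (F x) 0) as [->|Hn]; [ring|].
apply nonzeroE in Hn; congruence.
Qed.

(** After dropping the zero terms both lists are duplicate-free with the same elements, hence
    permutations of each other. This lets sums be reindexed when two index sets agree only where the
    summand is nonzero. *)
Lemma sum_over_support l l' F : NoDup l -> NoDup l' ->
  (forall x, F x <> 0 -> In x l -> In x l') ->
  (forall x, F x <> 0 -> In x l' -> In x l) ->
  sum_over l F = sum_over l' F.
Proof.
intros Hl Hl' H1 H2.
rewrite <- (sum_over_filter_nonzero l), <- (sum_over_filter_nonzero l').
apply sum_over_perm, NoDup_Permutation; try (apply NoDup_filter; assumption).
intros x; rewrite 2!filter_In, nonzeroE; split; intros [Hx HF]; auto.
Qed.

Lemma sum_over_map l (p : R -> R) F :
  sum_over l (fun x => F (p x)) = sum_over (map p l) F.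
Proof. unfold sum_over; rewrite map_map; reflexivity. Qed.

(** * Calculus of [bigO_infty] *)

Lemma bigO_ext u u' v :
  Rbar_locally p_infty (fun x => u x = u' x) ->
  bigO_infty u v -> bigO_infty u' v.
Proof.
intros He [K HK]; exists K.
generalize (filter_and _ _ He HK); apply filter_imp.
intros x [<- Hx]; exact Hx.
Qed.

Lemma bigO_ext_r u v v' :
  (forall x, v x = v' x) -> bigO_infty u v -> bigO_infty u v'.
Proof.
intros He [K HK]; exists K; revert HK; apply filter_imp.
intros x Hx; rewrite <- He; exact Hx.
Qed.

Lemma bigO_0 v : bigO_infty (fun _ => 0) v.
Proof.
exists 0; apply filter_forall; intros x; rewrite Rabs_R0; lra.
Qed.

Lemma bigO_plus u u' v :
  bigO_infty u v -> bigO_infty u' v -> bigO_infty (fun x => u x + u' x) v.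
Proof.
intros [K HK] [K' HK']; exists (K + K').
generalize (filter_and _ _ HK HK'); apply filter_imp.
intros x [Hx Hx']; pose proof (Rabs_triang (u x) (u' x)); lra.
Qed.

Lemma bigO_mult u v u' v' :
  bigO_infty u v -> bigO_infty u' v' ->
  bigO_infty (fun x => u x * u' x) (fun x => v x * v' x).
Proof.
intros [K HK] [K' HK']; exists (K * K').
generalize (filter_and _ _ HK HK'); apply filter_imp.
intros x [Hx Hx']; rewrite 2!Rabs_mult.
replace (K * K' * (Rabs (v x) * Rabs (v' x)))
  with ((K * Rabs (v x)) * (K' * Rabs (v' x))) by ring.
apply Rmult_le_compat; auto using Rabs_pos.
Qed.

Lemma bigO_scal k u v : bigO_infty u v -> bigO_infty (fun x => k * u x) v.
Proof.
intros [K HK]; exists (Rabs k * K); revert HK; apply filter_imp.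
intros x Hx; rewrite Rabs_mult, Rmult_assoc.
apply Rmult_le_compat_l; [apply Rabs_pos|exact Hx].
Qed.

Lemma bigO_sum_n_m (u : nat -> R -> R) v n k :
  (forall i, (n <= i <= k)%nat -> bigO_infty (u i) v) ->
  bigO_infty (fun x => sum_n_m (fun i => u i x) n k) v.
Proof.
intros Hu; induction k as [|k IH].
- destruct n.
  + apply (bigO_ext (u O)); [|apply Hu; lia].
    apply filter_forall; intros x; rewrite sum_n_n; reflexivity.
  + apply (bigO_ext (fun _ => 0)); [|apply bigO_0].
    apply filter_forall; intros x; rewrite sum_n_m_zero by lia; reflexivity.
- destruct (Nat.le_gt_cases n (S k)).
  + apply (bigO_ext (fun x => sum_n_m (fun i => u i x) n k + u (S k) x)).
    * apply filter_forall; intros x; rewrite sum_n_Sm by lia; reflexivity.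
    * apply bigO_plus; [apply IH; intros; apply Hu; lia|apply Hu; lia].
  + apply (bigO_ext (fun _ => 0)); [|apply bigO_0].
    apply filter_forall; intros x; rewrite sum_n_m_zero by lia; reflexivity.
Qed.

Lemma eventually_comp_scale k (P : R -> Prop) : 0 < k ->
  Rbar_locally p_infty P -> Rbar_locally p_infty (fun x => P (k * x)).
Proof.
intros Hk [M HM]; exists (M / k); intros x Hx; apply HM.
apply (Rmult_lt_compat_l k) in Hx; [|exact Hk].
replace (k * (M / k)) with M in Hx by (field; lra); exact Hx.
Qed.

Lemma bigO_comp_scale k u v : 0 < k ->
  bigO_infty u v -> bigO_infty (fun x => u (k * x)) (fun x => v (k * x)).
Proof.
intros Hk [K HK]; exists K.
exact (eventually_comp_scale k _ Hk HK).
Qed.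

Lemma bigO_exp_le s s' u : s' <= s ->
  bigO_infty u (fun l => exp ((1 - s) * l)) ->
  bigO_infty u (fun l => exp ((1 - s') * l)).
Proof.
(* The given constant carries no sign information, and the comparison of exponentials is multiplied
   by it. *)
intros Hs [K HK]; exists (Rabs K).
assert (Hpos : Rbar_locally p_infty (fun x => 0 < x))
  by (exists 0; intros x Hx; exact Hx).
generalize (filter_and _ _ HK Hpos); apply filter_imp.
intros x [Hx Hx0]; apply (Rle_trans _ _ _ Hx).
rewrite 2!(Rabs_pos_eq (exp _)) by (left; apply exp_pos).
apply (Rle_trans _ (Rabs K * exp ((1 - s) * x))).
- apply Rmult_le_compat_r; [left; apply exp_pos|apply Rle_abs].
- apply Rmult_le_compat_l; [apply Rabs_pos|].
  destruct (Rle_lt_or_eq_dec _ _ Hs) as [Hlt| ->]; [|apply Rle_refl].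
  left; apply exp_increasing; nra.
Qed.

Lemma bigO_exp_refl s :
  bigO_infty (fun l => exp ((1 - s) * l)) (fun l => exp ((1 - s) * l)).
Proof. exists 1; apply filter_forall; intros x; lra. Qed.

Lemma eventually_ge1 : Rbar_locally p_infty (fun l => 1 <= l).
Proof. exists 1; intros x Hx; lra. Qed.

(** Membership in [P] is decided classically, which turns [P] into a boolean filter on [l]. *)
Lemma enumerates_of_incl (l : list R) (P : R -> Prop) :
  (forall s, P s -> In s l) -> exists l', enumerates l' P.
Proof.
intros HP.
set (p := fun s => if excluded_middle_informative (P s) then true else false).
exists (nodup Req_EM_T (filter p l)); split; [apply NoDup_nodup|].
intros s; rewrite nodup_In, filter_In; unfold p.
destruct (excluded_middle_informative (P s)) as [Hs|Hs]; split; auto; try tauto.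
intros [_ Hf]; discriminate.
Qed.

(** * Numerical facts about the steps, [eta], [alpha] and the exponents *)

Section LadderFacts.
Variable L : ladder.
Local Notation m := (steps L).
Local Notation rho := (rho L).
Local Notation len := (len L).
Local Notation gap := (gap L).
Local Notation h := (h L).
Local Notation g := (g L).
Local Notation eta := (eta L).
Local Notation alpha := (alpha L).

Lemma eta_rho : eta * rho m = 1.
Proof. unfold Defs.eta; pose proof (rho_last L); field; lra. Qed.

Lemma eta_gt1 : 1 < eta.
Proof. pose proof eta_rho; pose proof (rho_last L); nra. Qed.

Lemma len_pos k : (1 <= k <= m)%nat -> 0 < len k.
Proof. intros Hk; unfold Defs.len; pose proof (a_lt_b L k Hk); lra. Qed.

Lemma gap_ge0 k : (1 <= k <= m - 1)%nat -> 0 <= gap k.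
Proof. intros Hk; unfold Defs.gap; pose proof (b_le_a L k Hk); lra. Qed.

(** Step [m - 1] exists and has positive length, so [a L m] is positive. The upper bound makes the
    powers of [len m] tend to 0. *)
Lemma len_last_bounds : 0 < len m < 1.
Proof.
pose proof (steps_ge2 L) as Hm.
split; [apply len_pos; lia|].
unfold Defs.len; rewrite b_last.
pose proof (b_le_a L (m - 1) ltac:(lia)) as H1.
replace (m - 1 + 1)%nat with m in H1 by lia.
pose proof (a_lt_b L (m - 1) ltac:(lia)).
pose proof (I_sub01 L (m - 1) ltac:(lia)).
lra.
Qed.

Lemma h_succ k : h (S k) = h k + rho (S k).
Proof. unfold Defs.h; rewrite sum_n_Sm by lia; reflexivity. Qed.

Lemma h_pred k : (1 <= k)%nat -> h (k - 1) = h k - rho k.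
Proof.
intros Hk; destruct k as [|k]; [lia|].
replace (S k - 1)%nat with k by lia; rewrite h_succ; ring.
Qed.

Lemma h_last : h (m - 1) = 1 - rho m.
Proof.
pose proof (steps_ge2 L); rewrite h_pred by lia.
unfold Defs.h; rewrite rho_sum; reflexivity.
Qed.

Lemma g_last : eta * g (m - 1) = 1.
Proof. unfold Defs.g; rewrite h_last; rewrite <- eta_rho; ring. Qed.

(** [g k] exceeds [g (S k)] by [rho (S k)]. Strictness ensures that the exponent 1 comes from
    [k = m - 1] only. *)
Lemma g_gt_last k : (1 <= k < m - 1)%nat -> rho m < g k.
Proof.
intros Hk; pose proof (g_ge_last L (S k) ltac:(lia)) as Hg.
pose proof (rho_pos L (S k) ltac:(lia)).
unfold Defs.g in *; rewrite h_succ in Hg; lra.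
Qed.

Lemma Rpower_eta_alpha : Rpower eta alpha = len m.
Proof.
pose proof eta_gt1; pose proof len_last_bounds.
unfold Rpower, Defs.alpha.
assert (0 < ln eta) by (rewrite <- ln_1; apply ln_increasing; lra).
replace (ln (len m) / ln eta * ln eta) with (ln (len m)) by (field; lra).
apply exp_ln; lra.
Qed.

Lemma Rpower_eta_mult l : 0 < l ->
  Rpower (eta * l) alpha = len m * Rpower l alpha.
Proof.
intros Hl; pose proof eta_gt1.
rewrite <- Rpower_mult_distr by lra; rewrite Rpower_eta_alpha; reflexivity.
Qed.

Lemma eta_pow_pos n : 0 < eta ^ n.
Proof. apply pow_lt; pose proof eta_gt1; lra. Qed.

Lemma Rpower_eta_pow n l : 0 < l ->
  Rpower (eta ^ n * l) alpha = len m ^ n * Rpower l alpha.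
Proof.
intros Hl; induction n as [|n IH].
- rewrite 2!pow_O, 2!Rmult_1_l; reflexivity.
- pose proof (eta_pow_pos n).
  replace (eta ^ S n * l) with (eta * (eta ^ n * l)) by (simpl; ring).
  rewrite Rpower_eta_mult by nra; rewrite IH; simpl; ring.
Qed.

(** Every admissible [i] differs from [m], so [g i >= rho m > rho m - rho i]. *)
Lemma critical_gt1 so : is_critical_point L so -> 1 < so.
Proof.
intros [[i [Hi [Hlt ->]]] _].
assert (i <> m) by (intros ->; lra).
pose proof (g_ge_last L i ltac:(lia)); pose proof (rho_pos L i Hi).
apply (Rmult_lt_reg_r (rho m - rho i)); [lra|].
replace (g i / (rho m - rho i) * (rho m - rho i)) with (g i) by (field; lra).
lra.
Qed.

(** By [index_decrease], an element up to [s0] is either a base exponent or the image of an element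
    smaller by at least [d]. Hence the elements up to [(k + 1) * d] lie among finitely many images
    of those up to [k * d], and there are none up to 0. *)
Lemma Ihat_finite_below so s0 : is_critical_point L so -> s0 < so ->
  exists l, enumerates l (fun s => Ihat L s /\ s < s0).
Proof.
intros so_critical Hs0; destruct (index_decrease L so s0 so_critical Hs0) as [d [d0 Hd]].
pose proof (eta_gt1) as Heta.
assert (Hk : forall k, exists l, forall s,
  Ihat L s -> s <= s0 -> s <= INR k * d -> In s l).
{ induction k as [|k [l Hl]].
  - exists nil; intros s Hs _ Hb; pose proof (Ihat_ge1 L s Hs); simpl in Hb; lra.
  - exists (map (fun i => eta * g i) (seq 1 (m - 1))
      ++ map (fun s => eta * s) l
      ++ flat_map (fun i => map (fun s => eta * (g i + rho i * s)) l)
           (seq 1 (m - 1))).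
    intros s Hs Hs' Hb; rewrite S_INR in Hb.
    destruct (Hd s (conj (Ihat_ge1 L s Hs) Hs')) as [He Hg].
    rewrite 2!in_app_iff; destruct Hs as [i Hi|s Hs|i s Hi Hs].
    + left; apply (in_map (fun i => eta * g i)), in_seq; lia.
    + right; left; apply (in_map (fun s => eta * s)).
      replace (eta * s / eta) with s in He by (field; lra).
      apply Hl; [exact Hs|lra|lra].
    + right; right; apply in_flat_map; exists i; split; [apply in_seq; lia|].
      apply (in_map (fun s => eta * (g i + rho i * s))).
      specialize (Hg i Hi); pose proof (rho_pos L i ltac:(lia)).
      replace ((eta * (g i + rho i * s) / eta - g i) / rho i) with s in Hg
        by (field; lra).
      apply Hl; [exact Hs|lra|lra]. }
destruct (INR_unbounded (s0 / d)) as [k Hkd].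
destruct (Hk k) as [l Hl].
apply (enumerates_of_incl l); intros s [Hs Hs']; apply Hl; [exact Hs|lra|].
assert (s0 = s0 / d * d) by (field; lra); nra.
Qed.

(** The exponents match: [1 - eta * (p + r)] plus [r * eta * (1 - (x / eta - p) / r)] is [1 - x].
    The choice [p = 0], [r = 1] serves the term at [eta * l], and [p = g k], [r = rho k] the terms
    of the sum. *)
Lemma bigO_shift (x p r : R) (D : R -> R) : 0 < r ->
  bigO_infty D (fun l => exp ((1 - (x / eta - p) / r) * l)) ->
  bigO_infty (fun l => exp ((1 - eta * (p + r)) * l) * D (r * eta * l))
    (fun l => exp ((1 - x) * l)).
Proof.
intros Hr HD; pose proof (eta_gt1) as Heta.
apply (bigO_comp_scale (r * eta)) in HD; [|apply Rmult_lt_0_compat; lra].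
refine (bigO_ext_r _ _ _ _ (bigO_mult _ _ _ _ (bigO_exp_refl (eta * (p + r))) HD)).
intros l; cbv beta; rewrite <- exp_plus; f_equal; field; lra.
Qed.

End LadderFacts.

(** * Continuous extension of the ladder function to the line *)

Definition clamp (t : R) : R := Rmax 0 (Rmin 1 t).

Lemma clamp_in t : 0 <= clamp t <= 1.
Proof.
unfold clamp; split; [apply Rmax_l|].
apply Rmax_lub; [lra|apply Rmin_l].
Qed.

Lemma clamp_id t : 0 <= t <= 1 -> clamp t = t.
Proof.
intros Ht; unfold clamp; rewrite Rmin_right by lra; apply Rmax_right; lra.
Qed.

Lemma clamp_lipschitz s t : Rabs (clamp s - clamp t) <= Rabs (s - t).
Proof.
unfold clamp, Rmax, Rmin.
repeat destruct Rle_dec; unfold Rabs; repeat destruct Rcase_abs; lra.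
Qed.

Lemma continuous_clamp t : continuous clamp t.
Proof.
apply filterlim_locally; intros eps; exists eps; intros s Hs.
exact (Rle_lt_trans _ _ _ (clamp_lipschitz s t) Hs).
Qed.

(** * Self-similarity and bounds of [E] *)

Section LadderFunction.
Variable L : ladder.
Variable C : R -> R.
Hypothesis C_ladder : is_ladder_function L C.
Local Notation m := (steps L).
Local Notation rho := (rho L).
Local Notation len := (len L).
Local Notation gap := (gap L).
Local Notation h := (h L).
Local Notation eta := (eta L).
Local Notation E := (E C).

Lemma ladder_function_bounds t : 0 <= t <= 1 -> 0 <= C t <= 1.
Proof. apply C_ladder. Qed.

(** [C] is continuous only relative to [0,1]. The values of [clamp] never leave [0,1], so the
    composite is continuous in the full sense, as the integrability criterion requires. *)
Lemma continuous_ladder_clamp t : continuous (fun t => C (clamp t)) t.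
Proof.
destruct C_ladder as [HC _].
apply filterlim_comp with (2 := HC (clamp t) (clamp_in t)).
intros P HP; generalize (continuous_clamp t _ HP).
unfold filtermap, within; apply filter_imp.
intros s Hs; exact (Hs (clamp_in s)).
Qed.

Lemma ex_RInt_exp_ladder l x y : 0 <= x <= 1 -> 0 <= y <= 1 ->
  ex_RInt (fun t => exp (l * C t)) x y.
Proof.
intros Hx Hy.
apply ex_RInt_ext with (fun t => exp (l * C (clamp t))).
- intros t Ht; rewrite clamp_id; [reflexivity|].
  revert Ht; unfold Rmin, Rmax; destruct Rle_dec; lra.
- apply (ex_RInt_continuous (V := R_CompleteNormedModule)); intros t _.
  apply (continuous_comp (fun t => l * C (clamp t)) exp).
  + apply (continuous_scal_r l (fun t => C (clamp t))).
    apply continuous_ladder_clamp.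
  + apply (ex_derive_continuous exp); auto_derive; exact I.
Qed.

Lemma E_ge1 l : 0 <= l -> 1 <= E l.
Proof.
intros Hl; unfold Defs.E.
replace 1 with (RInt (fun _ => 1) 0 1) at 1.
- apply RInt_le; [lra|apply ex_RInt_const|apply ex_RInt_exp_ladder; lra|].
  intros t Ht; pose proof (ladder_function_bounds t ltac:(lra)).
  rewrite <- exp_0; destruct (Rle_lt_or_eq_dec 0 (l * C t)) as [Hp|<-]; [nra| |lra].
  left; apply exp_increasing; exact Hp.
- rewrite RInt_const; unfold scal; simpl; unfold mult; simpl; ring.
Qed.

Lemma E_le_exp l : 0 <= l -> E l <= exp l.
Proof.
intros Hl; unfold Defs.E.
replace (exp l) with (RInt (fun _ => exp l) 0 1).
- apply RInt_le; [lra|apply ex_RInt_exp_ladder; lra|apply ex_RInt_const|].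
  intros t Ht; pose proof (ladder_function_bounds t ltac:(lra)).
  destruct (Rle_lt_or_eq_dec (l * C t) l) as [Hp|Heq]; [nra| |rewrite Heq; lra].
  left; apply exp_increasing; exact Hp.
- rewrite RInt_const; unfold scal; simpl; unfold mult; simpl; ring.
Qed.

Lemma RInt_exp_ladder_step k l : (1 <= k <= m)%nat ->
  RInt (fun t => exp (l * C t)) (a L k) (b L k)
  = len k * exp (h (k - 1) * l) * E (rho k * l).
Proof.
intros Hk.
pose proof (len_pos L k Hk) as Hlen.
pose proof (a_lt_b L k Hk) as Hab.
assert (Hlab : len k = b L k - a L k) by reflexivity.
destruct C_ladder as [_ [_ [_ [_ [HC _]]]]].
set (f := fun t => exp (rho k * l * C t)).
(* The affine substitution carries [a L k] to 0 and [b L k] to 1. *)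
assert (e0 : / len k * a L k + - (a L k / len k) = 0) by (field; lra).
assert (e1 : / len k * b L k + - (a L k / len k) = 1) by
  (rewrite Hlab; field; lra).
assert (Hlin : RInt (fun y => scal (/ len k) (f (/ len k * y + - (a L k / len k))))
    (a L k) (b L k) = E (rho k * l)).
{ transitivity (RInt f (/ len k * a L k + - (a L k / len k))
                      (/ len k * b L k + - (a L k / len k))).
  - apply (RInt_comp_lin (V := R_CompleteNormedModule)).
    rewrite e0, e1; apply ex_RInt_exp_ladder; lra.
  - rewrite e0, e1; reflexivity. }
assert (Hex : ex_RInt (fun y => scal (/ len k) (f (/ len k * y + - (a L k / len k))))
    (a L k) (b L k)).
{ apply (ex_RInt_comp_lin f); rewrite e0, e1; apply ex_RInt_exp_ladder; lra. }
rewrite <- Hlin.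
change (?x * RInt ?F ?p ?q) with (scal x (RInt F p q)).
rewrite <- (RInt_scal (V := R_CompleteNormedModule)) by exact Hex.
apply RInt_ext; intros t Ht.
rewrite Rmin_left, Rmax_right in Ht by lra.
rewrite (HC k t Hk) by lra.
unfold scal; simpl; unfold mult; simpl; unfold f.
replace (/ len k * t + - (a L k / len k)) with ((t - a L k) / len k)
  by (field; lra).
replace (l * (h (k - 1) + rho k * C ((t - a L k) / len k)))
  with (h (k - 1) * l + rho k * l * C ((t - a L k) / len k)) by ring.
rewrite exp_plus; field; lra.
Qed.

Lemma RInt_exp_ladder_gap k l : (1 <= k <= m - 1)%nat ->
  RInt (fun t => exp (l * C t)) (b L k) (a L (k + 1))
  = gap k * exp (h k * l).
Proof.
intros Hk.
destruct C_ladder as [_ [_ [_ [_ [_ HC]]]]].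
pose proof (b_le_a L k Hk).
rewrite (RInt_ext _ (fun _ => exp (h k * l))).
- rewrite RInt_const; reflexivity.
- intros t Ht; rewrite Rmin_left, Rmax_right in Ht by lra.
  rewrite (HC k t Hk) by lra; f_equal; ring.
Qed.

(** The integral is cut at the ends of all steps, where [C] is either a scaled copy of itself or
    constant. *)
Lemma E_self_similar l :
  E l = sum_n_m (fun k => len k * exp (h (k - 1) * l) * E (rho k * l)
                          + gap k * exp (h k * l)) 1 (m - 1)
        + len m * exp (h (m - 1) * l) * E (rho m * l).
Proof.
pose proof (steps_ge2 L) as Hm.
assert (Hab : forall k, (1 <= k <= m)%nat -> 0 <= a L k <= 1 /\ 0 <= b L k <= 1).
{ intros k Hk; pose proof (I_sub01 L k Hk); pose proof (a_lt_b L k Hk); lra. }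
(* The induction runs over pairs of a step and the gap after it; the last step has no gap and is
   added separately. *)
assert (Hn : forall n, (n <= m - 1)%nat ->
  RInt (fun t => exp (l * C t)) 0 (a L (n + 1))
  = sum_n_m (fun k => len k * exp (h (k - 1) * l) * E (rho k * l)
                      + gap k * exp (h k * l)) 1 n).
{ induction n as [|n IH]; intros Hn.
  - rewrite sum_n_m_zero by lia; simpl (0 + 1)%nat; rewrite a_first.
    exact (RInt_point (V := R_CompleteNormedModule) 0 _).
  - rewrite sum_n_Sm by lia; rewrite <- IH by lia.
    rewrite <- RInt_exp_ladder_step, <- RInt_exp_ladder_gap by lia.
    replace (n + 1)%nat with (S n) by lia.
    pose proof (Hab (S n) ltac:(lia)).
    pose proof (Hab (S n + 1)%nat ltac:(lia)).
    rewrite (RInt_Chasles (V := R_CompleteNormedModule) _ (a L (S n)) (b L (S n)));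
      try (apply ex_RInt_exp_ladder; lra).
    rewrite (RInt_Chasles (V := R_CompleteNormedModule) _ 0 (a L (S n)));
      try (apply ex_RInt_exp_ladder; lra).
    reflexivity. }
pose proof (Hab m ltac:(lia)).
rewrite <- (Hn (m - 1)%nat) by lia.
rewrite <- RInt_exp_ladder_step by lia.
replace (m - 1 + 1)%nat with m by lia.
rewrite b_last; unfold Defs.E; symmetry.
apply (RInt_Chasles (V := R_CompleteNormedModule)); apply ex_RInt_exp_ladder; lra.
Qed.

(** Because [eta * rho m = 1], the contribution of the last step to [E (eta * l)] is exactly the
    term that [f] subtracts. *)
Lemma f_sum l :
  Defs.f L C l = sum_n_m (fun k =>
    len k * exp (h (k - 1) * (eta * l)) * E (rho k * eta * l)
    + gap k * exp (h k * (eta * l))) 1 (m - 1).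
Proof.
unfold Defs.f; rewrite (E_self_similar (eta * l)).
replace (rho m * (eta * l)) with l
  by (rewrite <- Rmult_assoc, (Rmult_comm (rho m)), eta_rho; ring).
replace (h (m - 1) * (eta * l)) with ((eta - 1) * l)
  by (rewrite h_last; pose proof (eta_rho L) as He;
      replace ((1 - rho m) * (eta * l)) with ((eta - eta * rho m) * l) by ring;
      rewrite He; ring).
unfold Rminus; rewrite Rplus_assoc, Rplus_opp_r, Rplus_0_r.
apply sum_n_m_ext; intros k; rewrite (Rmult_assoc (rho k)); reflexivity.
Qed.

Lemma f_ge0 l : 0 <= l -> 0 <= Defs.f L C l.
Proof.
intros Hl; rewrite f_sum; pose proof (eta_gt1 L).
rewrite <- (sum_n_m_R0 (fun _ => 0) 1 (m - 1)) by reflexivity.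
apply sum_n_m_Rle; intros k Hk.
pose proof (len_pos L k ltac:(lia)); pose proof (gap_ge0 L k Hk).
pose proof (rho_pos L k ltac:(lia)).
assert (0 <= rho k * eta * l) 
  by (apply Rmult_le_pos; [apply Rmult_le_pos|]; lra).
pose proof (E_ge1 (rho k * eta * l) ltac:(lra)).
pose proof (exp_pos (h (k - 1) * (eta * l))).
pose proof (exp_pos (h k * (eta * l))).
apply Rplus_le_le_0_compat; apply Rmult_le_pos; try lra;
  apply Rmult_le_pos; lra.
Qed.

(** In the k-th term [E x <= exp x] raises the exponent from [h (k - 1)] to [h k], and
    [h k <= 1 - rho m] becomes [eta - 1] after multiplication by [eta]. *)
Lemma f_le l : 0 <= l ->
  Defs.f L C l <= sum_n_m (fun k => len k + gap k) 1 (m - 1) * exp ((eta - 1) * l).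
Proof.
intros Hl; rewrite f_sum; pose proof (eta_gt1 L) as Heta.
rewrite (Rmult_comm (sum_n_m _ _ _)), <- sum_n_m_Rmult.
apply sum_n_m_Rle; intros k Hk.
pose proof (len_pos L k ltac:(lia)); pose proof (gap_ge0 L k Hk).
pose proof (rho_pos L k ltac:(lia)).
assert (0 <= rho k * eta * l) 
  by (apply Rmult_le_pos; [apply Rmult_le_pos|]; lra).
pose proof (E_le_exp (rho k * eta * l) ltac:(lra)) as HE.
pose proof (exp_pos (h (k - 1) * (eta * l))).
assert (Hexp : exp (h k * (eta * l)) <= exp ((eta - 1) * l)).
{ assert (Hle : h k * (eta * l) <= (eta - 1) * l).
  { replace ((eta - 1) * l) with ((1 - rho m) * (eta * l)).
    - pose proof (h_le_last L k Hk).
      apply Rmult_le_compat_r; [apply Rmult_le_pos|]; lra.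
    - replace ((1 - rho m) * (eta * l)) with ((eta - eta * rho m) * l) by ring.
      rewrite eta_rho; reflexivity. }
  destruct (Rle_lt_or_eq_dec _ _ Hle) as [Hlt| ->]; [|lra].
  left; apply exp_increasing; exact Hlt. }
assert (Hmul : exp (h (k - 1) * (eta * l)) * E (rho k * eta * l)
  <= exp (h k * (eta * l))).
{ replace (exp (h k * (eta * l)))
    with (exp (h (k - 1) * (eta * l)) * exp (rho k * eta * l)).
  - apply Rmult_le_compat_l; lra.
  - rewrite <- exp_plus; f_equal; rewrite h_pred by lia; ring. }
rewrite (Rmult_comm (exp _)), Rmult_plus_distr_r.
apply Rplus_le_compat; [rewrite Rmult_assoc|]; apply Rmult_le_compat_l; lra.
Qed.

End LadderFunction.

(** * Convergence of telescoping sums *)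

Lemma Series_telescope (u v : nat -> R) (l : R) :
  (forall n, u n = v (S n) - v n) -> is_lim_seq v l -> Series u = l - v O.
Proof.
intros Hu Hv; apply is_series_unique.
assert (Hlim : is_lim_seq (sum_n u) (l - v O)).
{ apply (is_lim_seq_ext (fun n => v (S n) - v O)).
  - induction n as [|n IH].
    + rewrite sum_O; symmetry; apply Hu.
    + rewrite sum_Sn, <- IH, Hu; unfold plus; simpl; ring.
  - apply is_lim_seq_minus'; [|apply is_lim_seq_const].
    apply (is_lim_seq_incr_1 v); exact Hv. }
exact Hlim.
Qed.

(** Monotone convergence with an explicit bound on the total increase, so that [W] can later be
    chosen independently of [l]. *)
Lemma increasing_bounded_increments (v w : nat -> R) (k W : R) :
  (forall n, 0 <= v (S n) - v n <= k * w n) -> 0 <= k ->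
  (forall n, sum_n w n <= W) ->
  exists l : R, is_lim_seq v l /\ 0 <= l - v O <= k * W.
Proof.
intros Hv Hk HW.
assert (Hincr : forall n, v n <= v (S n)) by (intros n; specialize (Hv n); lra).
assert (Hsum : forall n, v (S n) <= v O + k * sum_n w n).
{ induction n as [|n IH].
  - rewrite sum_O; specialize (Hv O); lra.
  - rewrite sum_Sn; unfold plus; simpl; specialize (Hv (S n)); lra. }
assert (Hbd : forall n, v n <= v O + k * W).
{ intros n; apply (Rle_trans _ _ _ (Hincr n)), (Rle_trans _ _ _ (Hsum n)).
  apply Rplus_le_compat_l, Rmult_le_compat_l; auto. }
destruct (ex_finite_lim_seq_incr v _ Hincr Hbd) as [l Hl].
exists l; split; [exact Hl|].
pose proof (is_lim_seq_incr_compare v l Hl Hincr O).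
pose proof (is_lim_seq_le v (fun _ => v O + k * W) l (v O + k * W) Hbd Hl
  (is_lim_seq_const _)) as Hle; simpl in Hle; lra.
Qed.

(** Ratio test: consecutive terms have quotient [exp (- ((q - 1) * q ^ k)) / d], which tends to 0
    even for small [d]. *)
Lemma sum_n_superexponential_bounded (q d : R) : 1 < q -> 0 < d ->
  exists W, 0 <= W /\ forall n, sum_n (fun k => exp (- (q ^ k - 1)) / d ^ k) n <= W.
Proof.
intros Hq Hd.
set (w := fun k => exp (- (q ^ k - 1)) / d ^ k).
assert (Hw : forall k, 0 < w k).
{ intros k; apply Rdiv_lt_0_compat; [apply exp_pos|apply pow_lt; lra]. }
assert (Hex : ex_series w).
{ apply (ex_series_ext (fun k => Rabs (w k))).
  { intros k; apply Rabs_pos_eq; left; apply Hw. }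
  apply (ex_series_DAlembert w 0); [lra|intros k; specialize (Hw k); lra|].
  apply (is_lim_seq_ext (fun k => / d * exp (- ((q - 1) * q ^ k)))).
  - intros k; rewrite Rabs_pos_eq.
    + unfold w; pose proof (pow_lt d k Hd).
      replace (- (q ^ S k - 1)) with (- (q ^ k - 1) + - ((q - 1) * q ^ k))
        by (simpl; ring).
      rewrite exp_plus; simpl; pose proof (exp_pos (- (q ^ k - 1))); field; lra.
    + left; apply Rdiv_lt_0_compat; apply Hw.
  - replace (Finite 0) with (Rbar_mult (/ d) 0) by (simpl; f_equal; ring).
    apply is_lim_seq_scal_l.
    apply (is_lim_comp_seq exp _ m_infty); [exact is_lim_exp_m|
      exists O; intros; discriminate|].
    apply (proj1 (is_lim_seq_opp (fun k => (q - 1) * q ^ k) p_infty)).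
    replace p_infty with (Rbar_mult (q - 1) p_infty).
    + apply is_lim_seq_scal_l, is_lim_seq_geom_p; exact Hq.
    + simpl; destruct Rle_dec as [Hle|]; [|lra].
      destruct (Rle_lt_or_eq_dec _ _ Hle); [reflexivity|lra]. }
assert (HS : forall n, sum_n w n <= Series w).
{ intros n; apply (is_lim_seq_incr_compare (sum_n w) (Series w)).
  - exact (Series_correct w Hex).
  - intros k; rewrite sum_Sn; unfold plus; simpl; specialize (Hw (S k)); lra. }
exists (Series w); split; [|exact HS].
specialize (HS O); rewrite sum_O in HS; specialize (Hw O); lra.
Qed.

(** * The function [H] and the remainder *)

Section Periodic.
Variable L : ladder.
Variable C : R -> R.
Hypothesis C_ladder : is_ladder_function L C.
Local Notation m := (steps L).
Local Notation rho := (rho L).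
Local Notation len := (len L).
Local Notation gap := (gap L).
Local Notation h := (h L).
Local Notation g := (g L).
Local Notation eta := (eta L).
Local Notation alpha := (alpha L).
Local Notation E := (E C).
Local Notation H := (H L C).
Local Notation H1 := (H1 L C).

(** The function G of the outline. *)
Definition normalized (l : R) : R := E l / (Rpower l alpha * exp l).

Lemma f1_normalized l : 0 < l ->
  f1 L C l = normalized (eta * l) - normalized l.
Proof.
intros Hl; unfold f1, normalized, Defs.f.
rewrite Rpower_eta_mult by exact Hl.
pose proof (len_last_bounds L); pose proof (exp_pos l).
assert (0 < Rpower l alpha) by apply exp_pos.
replace (eta * l) with ((eta - 1) * l + l) by ring.
pose proof (exp_pos ((eta - 1) * l)).
rewrite exp_plus; field; lra.
Qed.

(** The bound [exp ((eta - 1) * l)] on [f], divided by [exp (eta * l)], leaves [exp (- l)]. *)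
Lemma f1_bounds l : 0 < l ->
  0 <= f1 L C l <= sum_n_m (fun k => len k + gap k) 1 (m - 1)
                   / len m * (exp (- l) / Rpower l alpha).
Proof.
intros Hl.
pose proof (f_ge0 L C C_ladder l ltac:(lra)) as Hge.
pose proof (f_le L C C_ladder l ltac:(lra)) as Hle.
pose proof (len_last_bounds L); pose proof (exp_pos (eta * l)).
assert (Hp : 0 < Rpower l alpha) by apply exp_pos.
assert (Hd : 0 < len m * Rpower l alpha * exp (eta * l))
  by (apply Rmult_lt_0_compat; [apply Rmult_lt_0_compat|]; lra).
unfold f1; split.
- apply Rmult_le_pos; [exact Hge|left; apply Rinv_0_lt_compat; exact Hd].
- apply (Rmult_le_reg_r _ _ _ Hd).
  unfold Rdiv at 1; rewrite Rmult_assoc, Rinv_l, Rmult_1_r by lra.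
  apply (Rle_trans _ _ _ Hle), Req_le.
  replace ((eta - 1) * l) with (- l + eta * l) by ring.
  rewrite exp_plus; field; lra.
Qed.

(* As [f1] is a difference of [normalized] at [eta * l] and [l], the two-sided
   series telescopes; at [eta^(-n) * l] the contribution vanishes since
   [alpha < 0]. *)
Lemma H_of_lim (l x : R) : 0 < l ->
  is_lim_seq (fun n => normalized (eta ^ n * l)) x -> H l = x.
Proof.
intros Hl Hx; pose proof (eta_gt1 L) as Heta.
unfold Defs.H, Zseries.
rewrite (Series_telescope _ (fun n => normalized (eta ^ n * l)) x).
2:{ intros n; rewrite <- pow_powerRZ, f1_normalized.
    - f_equal; f_equal; simpl; ring.
    - apply Rmult_lt_0_compat; [apply eta_pow_pos|exact Hl]. }
2:{ exact Hx. }
(* In the negative half the n-th term is G at [/ eta ^ n * l] minus G at [/ eta ^ S n * l], hence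
   the sign; its starting value cancels that of the other half. *)
rewrite (Series_telescope _ (fun n => - normalized (/ eta ^ n * l)) 0).
- rewrite pow_O, Rinv_1, Rmult_1_l; ring.
- intros n; rewrite powerRZ_neg'.
  rewrite <- pow_powerRZ.
  pose proof (eta_pow_pos L n); pose proof (eta_pow_pos L (S n)).
  rewrite f1_normalized.
  + replace (eta * (/ eta ^ S n * l)) with (/ eta ^ n * l); [rewrite Rminus_def, Rplus_comm, Rminus_def, Ropp_involutive; reflexivity|].
    simpl; field; lra.
  + apply Rmult_lt_0_compat; [apply Rinv_0_lt_compat; lra|exact Hl].
- replace (Finite 0) with (Rbar_opp 0) by (simpl; f_equal; ring).
  apply (proj1 (is_lim_seq_opp (fun n => normalized (/ eta ^ n * l)) 0)).
  pose proof (len_last_bounds L) as Hlen.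
  assert (Hp : 0 < Rpower l alpha) by apply exp_pos.
  (* Squeeze: [E x' <= exp x'] bounds G at [x' = / eta ^ n * l] by the inverse of [Rpower x' alpha],
     which is geometric with ratio [len m]. *)
  apply (is_lim_seq_le_le (fun _ => 0) _ (fun n => / Rpower l alpha * len m ^ n)).
  + intros n.
    pose proof (eta_pow_pos L n) as Hpow.
    set (x' := / eta ^ n * l).
    assert (Hx' : 0 < x').
    { apply Rmult_lt_0_compat; [apply Rinv_0_lt_compat; exact Hpow|exact Hl]. }
    pose proof (E_ge1 L C C_ladder x' ltac:(lra)).
    pose proof (E_le_exp L C C_ladder x' ltac:(lra)) as HE.
    pose proof (exp_pos x').
    assert (Hp' : 0 < Rpower x' alpha) by apply exp_pos.
    pose proof (pow_lt (len m) n ltac:(lra)).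
    assert (Hr : Rpower l alpha = len m ^ n * Rpower x' alpha).
    { rewrite <- Rpower_eta_pow by exact Hx'.
      unfold x'; f_equal; field; lra. }
    unfold normalized; split.
    * apply Rmult_le_pos; [lra|].
      left; apply Rinv_0_lt_compat, Rmult_lt_0_compat; lra.
    * replace (/ Rpower l alpha * len m ^ n) with (exp x' / (Rpower x' alpha * exp x'))
        by (rewrite Hr; field; lra).
      apply Rmult_le_compat_r; [|exact HE].
      left; apply Rinv_0_lt_compat, Rmult_lt_0_compat; lra.
  + apply is_lim_seq_const.
  + replace (Finite 0) with (Rbar_mult (/ Rpower l alpha) 0)
      by (simpl; f_equal; ring).
    apply is_lim_seq_scal_l, is_lim_seq_geom.
    rewrite Rabs_pos_eq; lra.
Qed.

(** The increments are [f1 (eta ^ n * l)]; for [l >= 1] they are dominated by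
    [exp (- l) / Rpower l alpha] times a summable sequence free of [l]. This rate is what makes the
    remainder bounded. *)
Lemma normalized_lim : exists W, 0 <= W /\ forall l, 1 <= l ->
  is_lim_seq (fun n => normalized (eta ^ n * l)) (H l) /\
  0 <= H l - normalized l <= exp (- l) / Rpower l alpha * W.
Proof.
pose proof (eta_gt1 L) as Heta; pose proof (len_last_bounds L) as Hlen.
destruct (sum_n_superexponential_bounded eta (len m)) as [W [HW0 HW]]; [lra|lra|].
set (K := sum_n_m (fun k => len k + gap k) 1 (m - 1) / len m).
assert (HK : 0 <= K).
(* [K >= 0] is read off from the two-sided bound at [l = 1]. *)
{ pose proof (f1_bounds 1 ltac:(lra)) as [Hge Hle]; fold K in Hle.
  assert (0 < exp (- (1)) / Rpower 1 alpha)
    by (apply Rdiv_lt_0_compat; apply exp_pos).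
  nra. }
exists (K * W); split; [apply Rmult_le_pos; assumption|]; intros l Hl.
assert (Hp : 0 < Rpower l alpha) by apply exp_pos.
pose proof (exp_pos (- l)) as He.
assert (Hk : 0 <= exp (- l) / Rpower l alpha * K).
{ apply Rmult_le_pos; [|exact HK].
  left; apply Rdiv_lt_0_compat; assumption. }
destruct (increasing_bounded_increments (fun n => normalized (eta ^ n * l))
  (fun k => exp (- (eta ^ k - 1)) / len m ^ k)
  (exp (- l) / Rpower l alpha * K) W) as [x [Hx Hbd]]; [|exact Hk|exact HW|].
- intros n.
  pose proof (eta_pow_pos L n) as Hn.
  assert (Hnl : 0 < eta ^ n * l) by (apply Rmult_lt_0_compat; lra).
  replace (eta ^ S n * l) with (eta * (eta ^ n * l)) by (simpl; ring).
  rewrite <- f1_normalized by exact Hnl.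
  destruct (f1_bounds _ Hnl) as [Hge Hle]; split; [exact Hge|].
  fold K in Hle; apply (Rle_trans _ _ _ Hle).
  rewrite Rpower_eta_pow by lra.
  pose proof (pow_lt (len m) n ltac:(lra)).
  replace (exp (- l) / Rpower l alpha * K * (exp (- (eta ^ n - 1)) / len m ^ n))
    with (K * (exp (- l) * exp (- (eta ^ n - 1)) / (len m ^ n * Rpower l alpha)))
    by (field; lra).
  apply Rmult_le_compat_l; [exact HK|].
  apply Rmult_le_compat_r.
  { left; apply Rinv_0_lt_compat, Rmult_lt_0_compat; lra. }
  rewrite <- exp_plus.
  (* From [(eta ^ n - 1) * (l - 1) >= 0] it follows that [eta ^ n * l >= l + (eta ^ n - 1)], which
     splits off the factor [exp (- l)]. *)
  assert (H1n : 1 <= eta ^ n) by (apply pow_R1_Rle; lra).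
  destruct (Rle_lt_or_eq_dec (- (eta ^ n * l)) (- l + - (eta ^ n - 1)))
    as [Hlt|Heq]; [nra| |rewrite Heq; apply Rle_refl].
  left; apply exp_increasing; exact Hlt.
- rewrite (H_of_lim l x ltac:(lra) Hx); split; [exact Hx|].
  rewrite pow_O, Rmult_1_l in Hbd; rewrite <- Rmult_assoc; exact Hbd.
Qed.

(** The sequence defining the limit at [eta * l] is the one at [l] shifted by one, so [H] is
    unchanged; the factor comes from the power. *)
Lemma H1_eta l : 1 <= l -> H1 (eta * l) = len m * H1 l.
Proof.
intros Hl; pose proof (eta_gt1 L) as Heta.
destruct normalized_lim as [W [_ HW]].
unfold Defs.H1; rewrite Rpower_eta_mult by lra.
rewrite (H_of_lim (eta * l) (H l)); [ring|nra|].
apply (is_lim_seq_ext (fun n => normalized (eta ^ S n * l))).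
- intros n; f_equal; simpl; ring.
- apply (is_lim_seq_incr_1 (fun n => normalized (eta ^ n * l))), HW; exact Hl.
Qed.

Definition remainder (l : R) : R := E l - H1 l * exp l.

Lemma remainder_bounded : exists W, forall l, 1 <= l ->
  Rabs (remainder l) <= W.
Proof.
destruct normalized_lim as [W [_ HW]]; exists W; intros l Hl.
destruct (HW l Hl) as [_ Hb].
assert (Hp : 0 < Rpower l alpha) by apply exp_pos.
pose proof (exp_pos l) as He.
assert (Hr : remainder l
  = - ((H l - normalized l) * (Rpower l alpha * exp l))).
{ unfold remainder, Defs.H1, normalized; field; lra. }
assert (Hpe : 0 < Rpower l alpha * exp l) by (apply Rmult_lt_0_compat; lra).
rewrite Hr, Rabs_Ropp, Rabs_pos_eq by (apply Rmult_le_pos; lra).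
replace W with (exp (- l) / Rpower l alpha * W * (Rpower l alpha * exp l)).
- apply Rmult_le_compat_r; lra.
- rewrite exp_Ropp; field; lra.
Qed.

(** [H1 l * exp l] is [E l] minus the remainder, so at most [exp l + W] in absolute value; division
    by [exp l >= 1] gives the bound. *)
Lemma H1_bounded : exists K, forall l, 1 <= l -> Rabs (H1 l) <= K.
Proof.
destruct remainder_bounded as [W HW]; exists (1 + W); intros l Hl.
specialize (HW l Hl).
pose proof (E_ge1 L C C_ladder l ltac:(lra)).
pose proof (E_le_exp L C C_ladder l ltac:(lra)).
assert (He : 1 <= exp l) by (pose proof (exp_ineq1_le l); lra).
assert (Hr : Rabs (H1 l) * exp l <= exp l + W).
{ replace (Rabs (H1 l) * exp l) with (Rabs (E l - remainder l)).
  - unfold Rminus; apply (Rle_trans _ _ _ (Rabs_triang _ _)).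
    rewrite Rabs_Ropp, (Rabs_pos_eq (E l)); lra.
  - unfold remainder.
    replace (E l - (E l - H1 l * exp l)) with (H1 l * exp l) by ring.
    rewrite Rabs_mult, (Rabs_pos_eq (exp l)); lra. }
pose proof (Rabs_pos (H1 l)); pose proof (Rabs_pos (remainder l)); nra.
Qed.

(* The value of [c1] at [s = eta * g k]. *)
Definition amplitude (k : nat) (l : R) : R :=
  - (len k * H1 (eta * rho k * l) + gap k) / len m.

(** Two expressions for [f] are compared: its definition and [f_sum], both with [E] written as
    [H1 * exp] plus the remainder. *)
Lemma remainder_recursion l : 1 <= l ->
  remainder l
  = sum_n_m (fun k => amplitude k l * exp ((1 - eta * g k) * l)) 1 (m - 1)
    + / len m * exp ((1 - eta) * l) * remainder (eta * l)
    - sum_n_m (fun k => len k / len m * exp ((1 - eta * (g k + rho k)) * l)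
                        * remainder (rho k * eta * l)) 1 (m - 1).
Proof.
intros Hl; pose proof (len_last_bounds L) as Hlen.
(* By [H1_eta] the two main terms cancel. *)
assert (Hf : Defs.f L C l =
  remainder (eta * l) - len m * exp ((eta - 1) * l) * remainder l).
{ unfold remainder, Defs.f; rewrite H1_eta by exact Hl.
  replace (eta * l) with ((eta - 1) * l + l) at 3 by ring.
  rewrite exp_plus; ring. }
(* In the k-th term of [f_sum] the [H1] part of [E] and the gap carry the same exponential, since
   [h (k - 1) + rho k = h k]; together they form the amplitude. *)
assert (Hs : sum_n_m (fun k => amplitude k l * exp ((1 - eta * g k) * l)) 1 (m - 1)
  - sum_n_m (fun k => len k / len m * exp ((1 - eta * (g k + rho k)) * l)
                        * remainder (rho k * eta * l)) 1 (m - 1)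
  = - (/ len m * exp ((1 - eta) * l)) * Defs.f L C l).
{ rewrite f_sum by exact C_ladder; rewrite <- sum_n_m_Rmult.
  match goal with |- ?x - ?y = _ =>
    replace (x - y) with (x + - (1) * y) by ring end.
  rewrite <- sum_n_m_Rmult, <- sum_n_m_Rplus.
  apply sum_n_m_ext_loc; intros k Hk.
  rewrite h_pred by lia; unfold amplitude, remainder, Defs.g.
  replace (rho k * eta * l) with (eta * rho k * l) by ring.
  replace ((1 - eta * (1 - h k)) * l)
    with ((1 - eta) * l + (h k - rho k) * (eta * l) + eta * rho k * l) by ring.
  replace ((1 - eta * (1 - h k + rho k)) * l)
    with ((1 - eta) * l + (h k - rho k) * (eta * l)) by ring.
  replace (h k * (eta * l))
    with ((h k - rho k) * (eta * l) + eta * rho k * l) by ring.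
  rewrite !exp_plus.
  match goal with |- ?x = ?y => change (@eq R x y) end; field; lra. }
match goal with |- _ = ?x + ?y - ?z =>
  replace (x + y - z) with ((x - z) + y) by ring end.
rewrite Hs, Hf.
replace ((1 - eta) * l) with (- ((eta - 1) * l)) by ring.
pose proof (exp_pos ((eta - 1) * l)).
rewrite exp_Ropp; field; lra.
Qed.

(** For [k < m - 1] the exponent [eta * g k] exceeds 1, so only the last index contributes. *)
Lemma c1_at_1 l : Defs.c1 L C 1 l = amplitude (m - 1) l.
Proof.
pose proof (steps_ge2 L) as Hm; pose proof (eta_gt1 L) as Heta.
pose proof (eta_rho L) as Her; unfold Defs.c1.
replace (m - 1)%nat with (S (m - 2)) at 1 by lia.
rewrite sum_n_Sm by lia.
rewrite (sum_n_m_R0 _ 1 (m - 2)).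
- replace (S (m - 2)) with (m - 1)%nat by lia; rewrite g_last.
  destruct (Req_EM_T 1 1) as [_|Hne]; [apply Rplus_0_l|contradiction].
- intros k Hk; destruct (Req_EM_T 1 (eta * g k)) as [Heq|]; [|reflexivity].
  pose proof (g_gt_last L k ltac:(lia)); nra.
Qed.

(** This is the bracket of the expansion with a minus sign. The power at [eta * (rho (m - 1) * l)]
    yields a factor [len m] that cancels the denominator. *)
Lemma amplitude_last l : 0 < l -> amplitude (m - 1) l =
  - (gap (m - 1) / len m + len (m - 1) * H (rho (m - 1) / rho m * l)
      * Rpower (rho (m - 1) * l) alpha).
Proof.
intros Hl; pose proof (steps_ge2 L) as Hm.
pose proof (rho_pos L (m - 1) ltac:(lia)) as Hr.
pose proof (len_last_bounds L) as Hlen; pose proof (rho_last L).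
unfold amplitude, Defs.H1.
rewrite (Rmult_assoc eta), Rpower_eta_mult by (apply Rmult_lt_0_compat; lra).
replace (rho (m - 1) / rho m * l) with (eta * (rho (m - 1) * l))
  by (unfold Defs.eta; field; lra).
field; lra.
Qed.

(** The comparison function is the constant 1, written as an exponential so that it combines with
    [bigO_exp_le] and [bigO_mult]. *)
Lemma amplitude_bounded k : (1 <= k <= m - 1)%nat ->
  bigO_infty (amplitude k) (fun l => exp ((1 - 1) * l)).
Proof.
intros Hk; pose proof (eta_gt1 L) as Heta; pose proof (len_last_bounds L) as Hlen.
pose proof (rho_pos L k ltac:(lia)) as Hr.
destruct (H1_bounded) as [K HK].
exists ((Rabs (len k) * K + Rabs (gap k)) * / len m).
(* Beyond this threshold the argument of [H1] is at least 1. *)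
exists (/ (eta * rho k)); intros l Hl.
assert (Hp : 0 < eta * rho k) by (apply Rmult_lt_0_compat; lra).
apply (Rmult_lt_compat_l _ _ _ Hp) in Hl; rewrite Rinv_r in Hl by lra.
specialize (HK (eta * rho k * l) ltac:(lra)).
replace ((1 - 1) * l) with 0 by ring.
rewrite exp_0, Rabs_R1, Rmult_1_r.
unfold amplitude, Rdiv; rewrite Rabs_mult, Rabs_Ropp.
rewrite (Rabs_pos_eq (/ len m)) by (left; apply Rinv_0_lt_compat; lra).
apply Rmult_le_compat_r; [left; apply Rinv_0_lt_compat; lra|].
apply (Rle_trans _ _ _ (Rabs_triang _ _)); rewrite Rabs_mult.
apply Rplus_le_compat_r, Rmult_le_compat_l; [apply Rabs_pos|exact HK].
Qed.

End Periodic.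

(** * Truncated expansions and their error *)

Section Expansion.
Variable L : ladder.
Variable C : R -> R.
Variable so : R.
Variable c : R -> R -> R.
Hypothesis C_ladder : is_ladder_function L C.
Hypothesis so_critical : is_critical_point L so.
Hypothesis c_coef : is_coefficients L C so c.
Local Notation m := (steps L).
Local Notation rho := (rho L).
Local Notation len := (len L).
Local Notation g := (g L).
Local Notation eta := (eta L).
Local Notation Ihat := (Ihat L).
Local Notation remainder := (remainder L C).
Local Notation amp := (amplitude L C).

(** All indices on the right of the recursion are below 1, the least element of [Ihat], so only [c1]
    survives. *)
Lemma c_at_1 l : 0 < l -> c 1 l = amp (m - 1) l.
Proof.
intros Hl; pose proof (critical_gt1 L so so_critical) as Hso.
pose proof (steps_ge2 L) as Hm; pose proof (eta_gt1 L) as Heta.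
pose proof (len_last_bounds L) as Hlen.
destruct (index_decrease L so 1 so_critical Hso) as [d [d0 Hd]].
destruct (Hd 1 ltac:(lra)) as [He Hg].
assert (H0 : forall s l', s < 1 -> 0 < l' -> c s l' = 0).
{ intros s l' Hs Hl'; apply (proj1 c_coef); [lra| |exact Hl'].
  intros Hi; pose proof (Ihat_ge1 L s Hi); lra. }
rewrite (proj2 c_coef); [|exact Hso| |exact Hl].
- unfold c_recursion; rewrite c1_at_1, H0, sum_n_m_R0; [ring| |lra|].
  + intros i Hi; specialize (Hg i Hi); pose proof (rho_pos L i ltac:(lia)).
    rewrite H0; [ring|lra|apply Rmult_lt_0_compat; [apply Rmult_lt_0_compat|]; lra].
  + apply Rmult_lt_0_compat; lra.
- rewrite <- (g_last L); apply Ihat_base; lia.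
Qed.

Variable s0 : R.
Hypothesis s0_lt : s0 < so.
Variable I0 : list R.
Hypothesis I0_enum : enumerates I0 (fun s => Ihat s /\ s < s0).

(** The sum S_x of the outline for [x <= s0]. The cutoff is a test inside the summand, so that sums
    for different [x] share the list [I0]. *)
Definition truncated (x l : R) : R :=
  sum_over I0 (fun s => if Rlt_dec s x then c s l * exp ((1 - s) * l) else 0).

Lemma c_nonzero_Ihat s l : s < so -> 0 < l -> c s l <> 0 -> Ihat s.
Proof.
intros Hs Hl Hc; apply NNPP; intros Hn; apply Hc.
apply (proj1 c_coef); assumption.
Qed.

(* Covers both closure maps of [Ihat]: [p = 0], [r = 1] for the first one,
   [p = g i], [r = rho i] for the second one. *)
Lemma truncated_shift (p r x l : R) : 0 < r -> 0 < l -> x <= s0 ->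
  (forall s, Ihat s -> Ihat (eta * (p + r * s))) ->
  (forall s, 1 <= s <= s0 -> (s / eta - p) / r < s) ->
  sum_over I0 (fun s => if Rlt_dec s x
     then c ((s / eta - p) / r) (r * eta * l) * exp ((1 - s) * l) else 0)
  = exp ((1 - eta * (p + r)) * l) * truncated ((x / eta - p) / r) (r * eta * l).
Proof.
intros Hr Hl Hx Hcl Hdec; pose proof (eta_gt1 L) as Heta.
destruct I0_enum as [HND HI0].
assert (Hrl : 0 < r * eta * l) 
  by (apply Rmult_lt_0_compat; [apply Rmult_lt_0_compat|]; lra).
set (psi := fun s => (s / eta - p) / r).
set (phi := fun s => eta * (p + r * s)).
assert (Hphi : forall s, psi (phi s) = s) by (intros s; unfold phi, psi; field; lra).
assert (Hpsi : forall s, phi (psi s) = s) by (intros s; unfold phi, psi; field; lra).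
(* The summand in terms of the source index; [phi] is the closure map and [psi] its inverse. *)
set (F := fun s => if Rlt_dec (phi s) x
  then c s (r * eta * l) * exp ((1 - phi s) * l) else 0).
transitivity (sum_over I0 (fun s => F (psi s))).
{ apply sum_over_ext; intros s _; unfold F; rewrite Hpsi; reflexivity. }
rewrite sum_over_map.
transitivity (sum_over I0 F).
- assert (HF : forall s, F s <> 0 -> phi s < x /\ c s (r * eta * l) <> 0).
  { intros s; unfold F; destruct (Rlt_dec (phi s) x) as [Hlt|]; [|lra].
    intros Hne; split; [exact Hlt|]; intros Hc; apply Hne; rewrite Hc; ring. }
  (* [I0] and its image under [psi] agree where [F] is nonzero: a nonzero [c] forces membership in
     [Ihat] and [psi] decreases indices; conversely [phi] preserves [Ihat], and the test keeps its
     value below [x]. *)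
  apply sum_over_support; [|exact HND| |].
  + apply Injective_map_NoDup; [|exact HND].
    intros s s' Heq; rewrite <- (Hpsi s), Heq; apply Hpsi.
  + intros s Hne Hin; destruct (HF s Hne) as [Hlt Hc].
    apply in_map_iff in Hin; destruct Hin as [s' [<- Hs']].
    apply HI0 in Hs'; destruct Hs' as [Hs' Hlt'].
    pose proof (Ihat_ge1 L s' Hs').
    specialize (Hdec s' ltac:(lra)); fold (psi s') in Hdec.
    apply HI0; split; [|lra].
    apply (c_nonzero_Ihat _ (r * eta * l)); [lra|exact Hrl|exact Hc].
  + intros s Hne Hin; destruct (HF s Hne) as [Hlt Hc].
    apply HI0 in Hin; apply in_map_iff; exists (phi s); split; [apply Hphi|].
    apply HI0; split; [apply Hcl, Hin|lra].
- unfold truncated; rewrite <- sum_over_scal; apply sum_over_ext; intros s _.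
  unfold F; fold (psi x).
  assert (Hiff : phi s < x <-> s < psi x).
  { assert (Hx' : x - phi s = eta * r * (psi x - s))
      by (unfold phi, psi; field; lra).
    assert (0 < eta * r) by (apply Rmult_lt_0_compat; lra).
    split; intros; nra. }
  destruct (Rlt_dec (phi s) x), (Rlt_dec s (psi x)); try tauto; [|ring].
  replace ((1 - phi s) * l)
    with ((1 - eta * (p + r)) * l + (1 - s) * (r * eta * l))
    by (unfold phi; ring).
  rewrite exp_plus; ring.
Qed.

Lemma truncated_c1 x l : x <= s0 ->
  sum_over I0 (fun s => if Rlt_dec s x
     then Defs.c1 L C s l * exp ((1 - s) * l) else 0)
  = sum_n_m (fun k => if Rlt_dec (eta * g k) x
      then amp k l * exp ((1 - eta * g k) * l) else 0) 1 (m - 1).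
Proof.
intros Hx; destruct I0_enum as [HND HI0].
set (F := fun k s => if Rlt_dec s x then
  (if Req_EM_T s (eta * g k) then amp k l else 0) * exp ((1 - s) * l) else 0).
transitivity (sum_over I0 (fun s => sum_n_m (fun k => F k s) 1 (m - 1))).
- apply sum_over_ext; intros s _; unfold F, Defs.c1, amplitude.
  destruct (Rlt_dec s x).
  + rewrite Rmult_comm, <- sum_n_m_Rmult.
    apply sum_n_m_ext; intros k; apply Rmult_comm.
  + symmetry; apply sum_n_m_R0; reflexivity.
- rewrite sum_over_sum_n_m; apply sum_n_m_ext_loc; intros k Hk.
  transitivity (sum_over (eta * g k :: nil) (F k)).
  + apply sum_over_support; [exact HND|repeat constructor; intros []| |].
    * intros s Hne _; left; unfold F in Hne.
      destruct (Rlt_dec s x), (Req_EM_T s (eta * g k)); try lra; auto.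
    * intros s Hne [<-|[]]; unfold F in Hne.
      destruct (Rlt_dec (eta * g k) x); [|lra].
      apply HI0; split; [apply Ihat_base; exact Hk|lra].
  + rewrite sum_over_cons; unfold F, sum_over; simpl.
    destruct (Req_EM_T (eta * g k) (eta * g k)) as [_|Hne]; [|contradiction].
    apply Rplus_0_r.
Qed.

Lemma index_lt s : 1 <= s <= s0 ->
  s / eta < s /\ forall i, (1 <= i <= m - 1)%nat -> (s / eta - g i) / rho i < s.
Proof.
intros Hs; destruct (index_decrease L so s0 so_critical s0_lt) as [d [d0 Hd]].
destruct (Hd s Hs) as [He Hg]; split; [lra|].
intros i Hi; specialize (Hg i Hi); lra.
Qed.

(** Each [c s] is expanded by its recursion, and each of the resulting sums is reindexed by
    [truncated_shift] or [truncated_c1]. *)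
Lemma truncated_recursion x l : 0 < l -> x <= s0 ->
  truncated x l
  = sum_n_m (fun k => if Rlt_dec (eta * g k) x
      then amp k l * exp ((1 - eta * g k) * l) else 0) 1 (m - 1)
    + / len m * exp ((1 - eta) * l) * truncated (x / eta) (eta * l)
    - sum_n_m (fun k => len k / len m * exp ((1 - eta * (g k + rho k)) * l)
        * truncated ((x / eta - g k) / rho k) (rho k * eta * l)) 1 (m - 1).
Proof.
intros Hl Hx; rewrite <- truncated_c1 by exact Hx.
pose proof (eta_gt1 L) as Heta; pose proof (len_last_bounds L) as Hlen.
assert (He : exp ((1 - eta) * l) * truncated (x / eta) (eta * l)
  = sum_over I0 (fun s => if Rlt_dec s x
     then c (s / eta) (eta * l) * exp ((1 - s) * l) else 0)).
{ replace (exp ((1 - eta) * l)) with (exp ((1 - eta * (0 + 1)) * l))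
    by (f_equal; ring).
  replace (x / eta) with ((x / eta - 0) / 1) by (field; lra).
  replace (eta * l) with (1 * eta * l) by ring.
  rewrite <- truncated_shift; [|lra|exact Hl|exact Hx| |].
  - apply sum_over_ext; intros s _.
    replace ((s / eta - 0) / 1) with (s / eta) by (field; lra); reflexivity.
  - intros s Hs; replace (eta * (0 + 1 * s)) with (eta * s) by ring.
    apply Ihat_eta; exact Hs.
  - intros s Hs; replace ((s / eta - 0) / 1) with (s / eta) by (field; lra).
    apply index_lt; exact Hs. }
rewrite Rmult_assoc, He, <- sum_over_scal.
(* The sign goes into [G], so that the whole right-hand side merges into one sum over [I0] and is
   compared term by term. *)
set (G := fun k s => - (len k / len m) * (if Rlt_dec s x
  then c ((s / eta - g k) / rho k) (rho k * eta * l) * exp ((1 - s) * l) else 0)).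
assert (Hs : forall k, (1 <= k <= m - 1)%nat ->
  - (1) * (len k / len m * exp ((1 - eta * (g k + rho k)) * l)
        * truncated ((x / eta - g k) / rho k) (rho k * eta * l))
  = sum_over I0 (G k)).
{ intros k Hk; unfold G; rewrite sum_over_scal, truncated_shift;
    [ring|apply rho_pos; lia|exact Hl|exact Hx| |].
  - intros s; apply Ihat_step; exact Hk.
  - intros s Hs; apply index_lt; [exact Hs|exact Hk]. }
match goal with |- _ = ?u - ?v => replace (u - v) with (u + - (1) * v) by ring end.
rewrite <- sum_n_m_Rmult, (sum_n_m_ext_loc _ _ _ _ Hs), <- sum_over_sum_n_m.
rewrite <- 2!sum_over_plus.
apply sum_over_ext; intros s Hin; apply I0_enum in Hin.
unfold G; destruct (Rlt_dec s x).
- rewrite (proj2 c_coef) by (tauto || lra); unfold c_recursion.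
  rewrite (sum_n_m_ext (fun k => - (len k / len m)
      * (c ((s / eta - g k) / rho k) (rho k * eta * l) * exp ((1 - s) * l)))
    (fun k => - exp ((1 - s) * l) * (len k / len m
      * c ((s / eta - g k) / rho k) (rho k * eta * l)))).
  + rewrite sum_n_m_Rmult; field; lra.
  + intros k; match goal with |- ?u = ?v => change (@eq R u v) end; ring.
- rewrite (sum_n_m_R0 (fun _ => _)); [ring|intros; ring].
Qed.

(** No exponent lies below 1, so the truncated sum is empty and boundedness of the remainder
    suffices. *)
Lemma remainder_truncated_small x : x <= 1 ->
  bigO_infty (fun l => remainder l - truncated x l) (fun l => exp ((1 - x) * l)).
Proof.
intros Hx; apply (bigO_ext remainder).
- apply filter_forall; intros l; unfold truncated.
  rewrite sum_over_0; [ring|].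
  intros s Hs; apply I0_enum in Hs; destruct Hs as [Hs _].
  pose proof (Ihat_ge1 L s Hs); destruct (Rlt_dec s x); lra.
- apply (bigO_exp_le 1); [exact Hx|].
  destruct (remainder_bounded L C C_ladder) as [W HW]; exists W.
  generalize eventually_ge1; apply filter_imp; intros l Hl.
  replace ((1 - 1) * l) with 0 by ring.
  rewrite exp_0, Rabs_R1, Rmult_1_r; apply HW; exact Hl.
Qed.

Lemma remainder_truncated x : x <= s0 ->
  bigO_infty (fun l => remainder l - truncated x l) (fun l => exp ((1 - x) * l)).
Proof.
destruct (index_decrease L so s0 so_critical s0_lt) as [d [d0 Hd]].
pose proof (eta_gt1 L) as Heta.
(* One use of the recursion lowers the index by at least [d], so [n] counts the uses needed to get
   down to 1. *)
assert (Hn : forall n y, y <= s0 -> y <= 1 + INR n * d ->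
  bigO_infty (fun l => remainder l - truncated y l) (fun l => exp ((1 - y) * l))).
{ induction n as [|n IH]; intros y Hy Hb.
  - apply remainder_truncated_small; simpl in Hb; lra.
  - destruct (Rle_lt_dec y 1) as [Hy1|Hy1].
    { apply remainder_truncated_small; exact Hy1. }
    rewrite S_INR in Hb.
    destruct (Hd y ltac:(lra)) as [He Hg].
    set (D := fun z l => remainder l - truncated z l).
    assert (HD : bigO_infty (D (y / eta)) (fun l => exp ((1 - y / eta) * l)))
      by (apply IH; lra).
    assert (HDk : forall k, (1 <= k <= m - 1)%nat ->
      bigO_infty (D ((y / eta - g k) / rho k))
        (fun l => exp ((1 - (y / eta - g k) / rho k) * l)))
      by (intros k Hk; specialize (Hg k Hk); apply IH; lra).
    (* Difference of the two recursions: amplitudes with [eta * g k < y] cancel. The forms [0 + 1]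
       and [1 * eta * l] fit [bigO_shift] with [p = 0], [r = 1]. *)
    apply (bigO_ext (fun l =>
      sum_n_m (fun k => if Rlt_dec (eta * g k) y then 0 else
        amp k l * exp ((1 - eta * g k) * l)) 1 (m - 1)
      + / len m * (exp ((1 - eta * (0 + 1)) * l) * D (y / eta) (1 * eta * l))
      + - (1) * sum_n_m (fun k => len k / len m
          * (exp ((1 - eta * (g k + rho k)) * l)
             * D ((y / eta - g k) / rho k) (rho k * eta * l))) 1 (m - 1))).
    + generalize eventually_ge1; apply filter_imp; intros l Hl.
      rewrite (remainder_recursion L C C_ladder l Hl).
      rewrite (truncated_recursion y l ltac:(lra) Hy); unfold D.
      replace (1 - eta * (0 + 1)) with (1 - eta) by ring.
      replace (1 * eta * l) with (eta * l) by ring.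
      rewrite (sum_n_m_ext (fun k => len k / len m
          * (exp ((1 - eta * (g k + rho k)) * l)
             * (remainder (rho k * eta * l)
                - truncated ((y / eta - g k) / rho k) (rho k * eta * l))))
        (fun k => len k / len m * exp ((1 - eta * (g k + rho k)) * l)
             * remainder (rho k * eta * l)
           + - (1) * (len k / len m * exp ((1 - eta * (g k + rho k)) * l)
             * truncated ((y / eta - g k) / rho k) (rho k * eta * l))))
        by (intros k; match goal with |- ?u = ?v => change (@eq R u v) end; ring).
      assert (Hsplit : sum_n_m (fun k => amp k l * exp ((1 - eta * g k) * l)) 1 (m - 1)
        = sum_n_m (fun k => if Rlt_dec (eta * g k) y then 0 else
            amp k l * exp ((1 - eta * g k) * l)) 1 (m - 1)
          + sum_n_m (fun k => if Rlt_dec (eta * g k) y then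
            amp k l * exp ((1 - eta * g k) * l) else 0) 1 (m - 1)).
      { rewrite <- sum_n_m_Rplus; apply sum_n_m_ext; intros k.
        match goal with |- ?u = ?v => change (@eq R u v) end.
        destruct Rlt_dec; ring. }
      rewrite Hsplit, sum_n_m_Rplus, sum_n_m_Rmult; ring.
    + apply bigO_plus; [apply bigO_plus|].
      (* The surviving amplitudes are bounded and have exponents [eta * g k >= y]. *)
      * apply bigO_sum_n_m; intros k Hk.
        destruct (Rlt_dec (eta * g k) y) as [_|Hge]; [apply bigO_0|].
        apply (bigO_exp_le (eta * g k)); [lra|].
        refine (bigO_ext_r _ _ _ _ (bigO_mult _ _ _ _ (amplitude_bounded L C C_ladder k Hk)
          (bigO_exp_refl (eta * g k)))).
        intros l; cbv beta; rewrite <- exp_plus; f_equal; ring.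
      * apply bigO_scal, (bigO_shift L); [lra|].
        replace ((y / eta - 0) / 1) with (y / eta) by (field; lra); exact HD.
      * apply bigO_scal, bigO_sum_n_m; intros k Hk.
        apply bigO_scal, (bigO_shift L); [apply rho_pos; lia|exact (HDk k Hk)]. }
intros Hx; destruct (INR_unbounded ((x - 1) / d)) as [n Hnd].
apply (Hn n); [exact Hx|].
assert (x - 1 = (x - 1) / d * d) by (field; lra); nra.
Qed.

End Expansion.

(** * The expansion and the number of its nonzero terms *)

Theorem theorem5
  (L : ladder) (C : R -> R) (so : R) (c : R -> R -> R)
  (C_ladder : is_ladder_function L C)
  (L_critical : has_critical_point L)
  (so_critical : is_critical_point L so)
  (c_coef : is_coefficients L C so c) :
  let m := steps L in
  (forall s', s' < so ->
     exists I' : list R,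
       enumerates I' (fun s => Ihat L s /\ 1 < s < s') /\
       bigO_infty
         (fun l =>
            E C l -
            (H L C l * Rpower l (alpha L) * exp l
             - (gap L (m - 1) / len L m
                + len L (m - 1) * H L C (rho L (m - 1) / rho L m * l)
                  * Rpower (rho L (m - 1) * l) (alpha L))
             + sum_over I' (fun s => c s l * exp ((1 - s) * l))))
         (fun l => exp ((1 - s') * l))) /\
  ((~ exists s_, s_ < so /\
      forall s, Ihat L s -> s_ < s < so -> forall l, 0 < l -> c s l = 0) ->
   forall N : nat, exists s', s' < so /\
     exists J : list R,
       NoDup J /\ (N <= length J)%nat /\
       forall s, In s J ->
         (Ihat L s /\ 1 < s < s') /\ exists l, 0 < l /\ c s l <> 0).
Proof.
intros m; subst m; pose proof (steps_ge2 L) as Hm.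
pose proof (critical_gt1 L so so_critical) as Hso.
split.
- intros s' Hs'.
  destruct (Ihat_finite_below L so s' so_critical Hs') as [I0 HI0].
  destruct (enumerates_of_incl I0 (fun s => Ihat L s /\ 1 < s < s')) as [I' HI'].
  { intros s [Hs Hlt]; apply HI0; split; [exact Hs|lra]. }
  exists I'; split; [exact HI'|].
  pose proof (remainder_truncated L C so c C_ladder so_critical c_coef
    s' Hs' I0 HI0 s' (Rle_refl s')) as Hrem.
  (* For [s' <= 1] both lists are empty and the bracket is absorbed by the error; for [s' > 1] it is
     the term of exponent 1 in the truncated sum. *)
  destruct (Rle_lt_dec s' 1) as [H1|H1].
  + apply (bigO_ext (fun l => (remainder L C l - truncated c I0 s' l)
                              + - (1) * amplitude L C (steps L - 1) l)).
    * generalize eventually_ge1; apply filter_imp; intros l Hl.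
      rewrite amplitude_last by lra; unfold remainder, truncated, Defs.H1.
      rewrite 2!sum_over_0; [ring| |].
      -- intros s Hs; apply HI' in Hs; lra.
      -- intros s Hs; apply HI0 in Hs; destruct Hs as [Hs Hlt].
         pose proof (Ihat_ge1 L s Hs); lra.
    * apply bigO_plus; [exact Hrem|].
      apply bigO_scal, (bigO_exp_le 1); [exact H1|].
      apply amplitude_bounded; [exact C_ladder|lia].
  + revert Hrem; apply bigO_ext.
    generalize eventually_ge1; apply filter_imp; intros l Hl.
    assert (Ht : truncated c I0 s' l
      = amplitude L C (steps L - 1) l + sum_over I' (fun s => c s l * exp ((1 - s) * l))).
    { rewrite <- (c_at_1 L C so c so_critical c_coef l) by lra.
      (* Below [s'] the set [Ihat] consists of 1 and the elements of [I']. *)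
      transitivity (sum_over (1 :: I') (fun s => c s l * exp ((1 - s) * l))).
      - unfold truncated.
        transitivity (sum_over I0 (fun s => c s l * exp ((1 - s) * l))).
        + apply sum_over_ext; intros s Hs; apply HI0 in Hs.
          destruct (Rlt_dec s s'); [reflexivity|tauto].
        + apply sum_over_support; [apply HI0| | |].
          * constructor; [|apply HI'].
            intros Hin; apply HI' in Hin; lra.
          * intros s _ Hs; apply HI0 in Hs; destruct Hs as [Hs Hlt].
            pose proof (Ihat_ge1 L s Hs) as Hge.
            destruct (Rle_lt_or_eq_dec _ _ Hge) as [Hgt|<-]; [|left; reflexivity].
            right; apply HI'; auto.
          * intros s _ [<-|Hs]; apply HI0.
            -- split; [|exact H1].
               rewrite <- (g_last L); apply Ihat_base; lia.
            -- apply HI' in Hs; tauto.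
      - rewrite sum_over_cons; replace ((1 - 1) * l) with 0 by ring.
        rewrite exp_0; ring. }
    rewrite Ht, amplitude_last by lra.
    unfold remainder, Defs.H1; ring.
- intros Hnot; induction N as [|N IH].
  + exists 1; split; [exact Hso|].
    exists nil; split; [constructor|split; [apply le_n|intros s []]].
  + destruct IH as [s' [Hs' [J [HND [HN HJ]]]]].
    (* [Rmax 1 s'] lies below [so], so by assumption some coefficient beyond it is nonzero; its
       index exceeds 1 and every element of [J]. *)
    assert (Hnew : exists s, Ihat L s /\ Rmax 1 s' < s < so /\
      exists l, 0 < l /\ c s l <> 0).
    { apply NNPP; intros Hno; apply Hnot; exists (Rmax 1 s').
      split; [apply Rmax_lub_lt; assumption|].
      intros s Hs Hb l Hl; apply NNPP; intros Hc; apply Hno.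
      exists s; repeat split; try tauto; exists l; tauto. }
    destruct Hnew as [s [Hs [Hb Hc]]].
    pose proof (Rmax_l 1 s'); pose proof (Rmax_r 1 s').
    (* The midpoint is a cutoff above the new index and still below [so]. *)
    exists ((s + so) / 2); split; [lra|].
    exists (s :: J); split; [|split].
    * constructor; [|exact HND].
      intros Hin; apply HJ in Hin; lra.
    * simpl; lia.
    * intros t [<-|Ht].
      -- split; [split; [exact Hs|lra]|exact Hc].
      -- destruct (HJ t Ht) as [[Hi Ht'] Hc']; split; [split; [exact Hi|lra]|exact Hc'].
Qed.
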